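(* For every Bruhat interval $[u,v]\subset S_n$ with $u<v$ there is a proper subset $I_{\mathrm{st}}\subsetneq[u,v]$ which is a strong hypercube decomposition of $[u,v]$ and satisfies $\widetilde{R}_{u,v}(q)=\widetilde{H}_{u,v,I_{\mathrm{st}}}(q)$.
   Context: $S_n$ is the symmetric group with simple reflections $s_i=(i\ i{+}1)$, length $\ell$, $\ell(u,v)=\ell(v)-\ell(u)$, and $T$ its transpositions. The Bruhat graph $\Gamma$ has vertex set $S_n$ and edges $w\to tw$ whenever $t\in T$, $\ell(w)<\ell(tw)$; Bruhat order is reachability; $\Gamma(u,v)$ is the induced subgraph on $[u,v]$. A diamond is a subgraph of $\Gamma$ with four distinct vertices $x_1,\dots,x_4$ and edges $x_1\to x_2\to x_4$, $x_1\to x_3\to x_4$; $X\subset[u,v]$ is diamond-closed in $[u,v]$ if it contains the fourth vertex of every diamond in $[u,v]$ of which it contains three vertices. $R$-polynomials: $R_{u,v}=0$ if $u\not\le v$, $R_{v,v}=1$, $R_{u,v}=R_{us,vs}$ if $s\in\mathrm{Des}(u)\cap\mathrm{Des}(v)$, $R_{u,v}=qR_{us,vs}+(q-1)R_{u,vs}$ if $s\in\mathrm{Des}(v)\setminus\mathrm{Des}(u)$, with $\mathrm{Des}(w)=\{s_i:ws_i<w\}$; $\widetilde{R}_{u,v}\in\mathbb{N}[q]$ is the unique polynomial with $R_{u,v}(q)=q^{\ell(u,v)/2}\widetilde{R}_{u,v}(q^{1/2}-q^{-1/2})$. For an order ideal $I\subset[u,v]$ and $x\in I$, $\mathcal{Y}_x=\{y\in[u,v]\setminus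 I:x\to y\}$, $\mathcal{A}_x$ the set of Bruhat antichains in $\mathcal{Y}_x$, with $Y_1\to Y_2$ iff $Y_1\subset Y_2$, $|Y_2\setminus Y_1|=1$. A strong hypercube cluster at $x$ is $\theta_x:\mathcal{A}_x\to[u,v]$ with (HC1) $\theta_x(\varnothing)=x$; (HC2) $\theta_x(\{y\})=y$; (HC3) $Y_1\to Y_2$ implies $\theta_x(Y_1)\to\theta_x(Y_2)$ in $\Gamma$; (HC4) if $|Y|=|Y'|=|Y\cap Y'|+1$ and $\theta_x(Y\cap Y'),\theta_x(Y),\theta_x(Y'),w$ form a diamond in $\Gamma(u,v)$ with top $w$, then $Y\cup Y'$ is an antichain and $\theta_x(Y\cup Y')=w$. A strong hypercube decomposition of $[u,v]$ is an order ideal $I=[u,z]$ ($z\in[u,v]$), diamond-closed in $[u,v]$, such that every $x\in I$ has a strong hypercube cluster relative to $I$. $\widetilde{H}_{u,v,I}(q)=\sum_{x\in I}\sum_{Y\in\mathcal{A}_x,\ \theta_x(Y)=v}q^{|Y|}\widetilde{R}_{u,x}(q)$. *)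

(* Defs.v *)
From HB Require Import structures.
From mathcomp Require Import all_boot all_order all_fingroup all_algebra.
From Stdlib Require Import ClassicalEpsilon.
Set Implicit Arguments. Unset Strict Implicit. Unset Printing Implicit Defensive.
Import GRing.Theory.

Section Bruhat.
Variable n : nat.
Notation perm := ('S_n).
Local Open Scope ring_scope.

Definition len (w : perm) : nat :=
  #|[set p : 'I_n * 'I_n | (p.1 < p.2)%N && (w p.2 < w p.1)%N]|.

Definition istransp (t : perm) : bool :=
  [exists i : 'I_n, exists j : 'I_n, (i != j) && (t == tperm i j)].

(* Composition as functions: comp f g = f o g.  In mathcomp (s * t) x = t (s x). *)
Definition comp (f g : perm) : perm := (g * f)%g.

Definition bedge : rel perm := fun w w' =>
  [exists t, istransp t && (w' == comp t w)] && (len w < len w')%N.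

Definition bruhat (u v : perm) : bool := connect bedge u v.

Definition bruhat_interval (u v : perm) : {set perm} := [set x | bruhat u x && bruhat x v].

(* s is a right descent of w : w s < w, with s simple (here ws < w iff len (ws) < len w). *)
Definition rdesc (w s : perm) : bool := (len (comp w s) < len w)%N.

Definition pick_desc (v : perm) : option ('I_n * 'I_n) :=
  [pick p : 'I_n * 'I_n | (val p.2 == (val p.1).+1) && rdesc v (tperm p.1 p.2)].

Fixpoint Rfuel (k : nat) (u v : perm) : {poly int} :=
  match k with
  | 0%N => if u == v then 1 else 0
  | k'.+1 =>
    if ~~ bruhat u v then 0 else
    if u == v then 1 else
    match pick_desc v with
    | Some p =>
      let s := tperm p.1 p.2 in
      if rdesc u s then Rfuel k' (comp u s) (comp v s)
      else 'X * Rfuel k' (comp u s) (comp v s) + ('X - 1) * Rfuel k' u (comp v s)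
    | None => 0
    end
  end.

Definition Rpoly (u v : perm) : {poly int} := Rfuel (len v) u v.

(* p is R~ for the polynomial P and length l:  P(q) = q^{l/2} p(q^{1/2} - q^{-1/2}),
   expressed with t = q^{1/2} ranging over nonzero rationals. *)
Definition isRtilde (P : {poly int}) (l : nat) (p : {poly int}) : Prop :=
  forall t : rat, t != 0 ->
    (map_poly (fun z : int => z%:~R : rat) P).[t ^+ 2]
    = t ^+ l * (map_poly (fun z : int => z%:~R : rat) p).[t - t^-1].

(* the (unique) polynomial R~_{u,v} *)
Definition Rtilde (u v : perm) : {poly int} :=
  epsilon (inhabits 0) (isRtilde (Rpoly u v) (len v - len u)).

Definition is_diamond (S : {set perm}) (x1 x2 x3 x4 : perm) : bool :=
  [&& all (fun x => x \in S) [:: x1; x2; x3; x4], uniq [:: x1; x2; x3; x4],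
      bedge x1 x2, bedge x2 x4, bedge x1 x3 & bedge x3 x4].

Definition diamond_closed (u v : perm) (X : {set perm}) : Prop :=
  X \subset bruhat_interval u v /\
  forall x1 x2 x3 x4, is_diamond (bruhat_interval u v) x1 x2 x3 x4 ->
    (3%N <= count (fun x => x \in X) [:: x1; x2; x3; x4])%N ->
    all (fun x => x \in X) [:: x1; x2; x3; x4].

Definition Yset (u v : perm) (I : {set perm}) (x : perm) : {set perm} :=
  [set y | (y \in bruhat_interval u v) && (y \notin I) && bedge x y].

Definition antichain (Y : {set perm}) : bool :=
  [forall y1 in Y, forall y2 in Y, (y1 != y2) ==> ~~ bruhat y1 y2].

Definition inA (u v : perm) (I : {set perm}) (x : perm) (Y : {set perm}) : bool :=
  (Y \subset Yset u v I x) && antichain Y.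

Definition strong_cluster (u v : perm) (I : {set perm}) (x : perm)
    (th : {set perm} -> perm) : Prop :=
  [/\ forall Y, inA u v I x Y -> th Y \in bruhat_interval u v,
      (* HC1 *) th set0 = x,
      (* HC2 *) forall y, y \in Yset u v I x -> th [set y] = y,
      (* HC3 *) forall Y1 Y2, inA u v I x Y1 -> inA u v I x Y2 ->
                Y1 \subset Y2 -> #|Y2 :\: Y1| = 1 -> bedge (th Y1) (th Y2)
    & (* HC4 *) forall Y Y' w, inA u v I x Y -> inA u v I x Y' ->
                #|Y| = #|Y'| -> #|Y| = (#|Y :&: Y'|).+1%N ->
                is_diamond (bruhat_interval u v) (th (Y :&: Y')) (th Y) (th Y') w ->
                antichain (Y :|: Y') /\ th (Y :|: Y') = w].

Definition strong_hcd (u v : perm) (I : {set perm}) (th : perm -> {set perm} -> perm)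
    : Prop :=
  exists z, [/\ z \in bruhat_interval u v, I = bruhat_interval u z, diamond_closed u v I
              & forall x, x \in I -> strong_cluster u v I x (th x)].

Definition Htilde (u v : perm) (I : {set perm}) (th : perm -> {set perm} -> perm)
    : {poly int} :=
  \sum_(x in I) \sum_(Y : {set perm} | inA u v I x Y && (th x Y == v))
     'X^#|Y| * Rtilde u x.

End Bruhat.

(* Main.v *)
Require Import Defs.
From mathcomp Require Import all_boot all_order all_fingroup all_algebra.
From mathcomp Require Import zify ring.
From Stdlib Require Import ClassicalEpsilon.
Set Implicit Arguments. Unset Strict Implicit. Unset Printing Implicit Defensive.

(* Let m be the largest value placed differently by u and v, at position a in u and at
   position b < a in v, and let I be the part of [u, v] where m stays at position a.
   Bruhat order is the order of the counts #{c < p | w c >= k}, which shows that I has a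
   maximum. From x in I one leaves I exactly by exchanging m with a smaller value at some
   position i < a; such exchanges form an antichain iff the values of x at the positions
   involved decrease, and then sorting these values together with m produces their join,
   which is the value of the cluster.
   For the polynomial identity, the tilde R-polynomials are computed by right
   multiplications with T_s + q in the Hecke algebra, where s may be any descent of v by
   the braid relations. Taking s = (b b+1) moves m one step towards a, and induction on
   a - b expands the polynomial of (u, v) as a sum over decreasing subsequences of v. *)

(** * Inversions, length, and the edges of the Bruhat graph *)

Section Length.
Variable n : nat.
Implicit Types (u v w x : 'S_n) (i j a b c : 'I_n).
Local Open Scope group_scope.

(** With the product of mathcomp, [tperm i j * w] exchanges the contents of positions [i] and [j] of
    [w]. An upward exchange raises the counts by 1 exactly on a rectangle. For the exchanges that
    leave I, all rectangles share the corner [(a, m)], so comparing them means comparing their other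
    corners [(i, x i)]: this is where decreasing sequences come from. Rotating raises the counts on
    the union of the rectangles, which makes it the join. The relation T_s^2 = 1 - q T_s says that
    T_s + q is the inverse of T_s, so the tilde R-polynomials below [v] are the coefficients of the
    inverse of the basis element of [v^-1]. The definition imposes the descent [pick_desc], while
    the expansion must follow the position of [m]; hence the need for the braid relations. The
    expansion reproduces itself from one position to the next because (T_s + q)^2 = 1 + q (T_s + q):
    the two terms on the right belong to a set of positions without and with b+1. Antichains are
    encoded by sets of positions, which do not depend on [x]; this is what allows the two sums in
    the H-polynomial to be exchanged. *)

Definition inversions w : {set 'I_n * 'I_n} :=
  [set p : 'I_n * 'I_n | (p.1 < p.2)%N && (w p.2 < w p.1)%N].

Lemma lenE w : len w = #|inversions w|. Proof. by []. Qed.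

(** Compares the inversions of [w] and of [tperm i j * w]: a pair whose order the transposition
    would reverse stays in place, so ordered pairs go to ordered pairs and injectivity survives. *)
Definition ordered_move (s : 'S_n) (p : 'I_n * 'I_n) :=
  if (s p.1 < s p.2)%N then (s p.1, s p.2) else p.

Lemma ordered_move_inj i j :
  {in [pred p : 'I_n * 'I_n | (p.1 < p.2)%N] &, injective (ordered_move (tperm i j))}.
Proof.
move=> [c d] [c' d']; rewrite !inE /= => cd cd'.
rewrite /ordered_move /=; case: ifP => h; case: ifP => h' [].
- by move=> /perm_inj -> /perm_inj ->.
- by move=> e1 e2; move: h'; rewrite -e1 -e2 !tpermK cd.
- by move=> e1 e2; move: h; rewrite e1 e2 !tpermK cd'.
by move=> -> ->.
Qed.

Lemma ordered_move_inversions w i j :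
  (i < j)%N -> (w i < w j)%N ->
  ordered_move (tperm i j) @: inversions w \subset inversions (tperm i j * w) :\ (i, j).
Proof.
move=> ij wij; apply/subsetP => q /imsetP [[c d]]; rewrite inE /= => /andP [cd wdc] ->.
rewrite /ordered_move /=; case: ifP => h; rewrite !inE /= !permM ?tpermK ?h ?cd ?andbT /=.
- rewrite wdc andbT; apply/eqP => -[e1 e2].
  have := congr1 (tperm i j) e1; have := congr1 (tperm i j) e2.
  rewrite !tpermK tpermL tpermR => ec ed; move: cd; rewrite ec ed; lia.
move: cd h wdc; rewrite xpair_eqE -!val_eqE /=.
by case: tpermP => [->|->|/eqP + /eqP +]; case: tpermP => [->|->|/eqP + /eqP +];
  rewrite -?val_eqE /=; lia.
Qed.

Lemma len_tperm_lt w i j :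
  (i < j)%N -> (w i < w j)%N -> (len w < len (tperm i j * w))%N.
Proof.
move=> ij wij; have := subset_leq_card (ordered_move_inversions ij wij).
rewrite card_in_imset; last first.
  by apply: sub_in2 (@ordered_move_inj i j) => p; rewrite !inE => /andP [].
have : (i, j) \in inversions (tperm i j * w).
  by rewrite inE /= ij !permM tpermL tpermR wij.
by rewrite !lenE (cardsD1 (i, j) (inversions (_ * _))) => -> /=.
Qed.

Lemma len_tperm_gtE w i j :
  (i < j)%N -> (len w < len (tperm i j * w))%N = (w i < w j)%N.
Proof.
move=> ij; apply/idP/idP; last exact: len_tperm_lt.
move=> h; case: (ltngtP (w i) (w j)) => // [lt|/val_inj/perm_inj e]; last by move: ij; rewrite e ltnn.
have := @len_tperm_lt (tperm i j * w) i j ij.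
by rewrite !permM tpermL tpermR mulgA tperm2 mul1g => /(_ lt); lia.
Qed.

Lemma len_tperm_ltE w i j :
  (i < j)%N -> (len (tperm i j * w) < len w)%N = (w j < w i)%N.
Proof.
move=> ij; have := len_tperm_gtE (tperm i j * w) ij.
by rewrite !permM tpermL tpermR mulgA tperm2 mul1g.
Qed.

Lemma len_adjacent w i j :
  (j = i.+1 :> nat) -> (w i < w j)%N -> len (tperm i j * w) = (len w).+1.
Proof.
move=> ji wij; have ij : (i < j)%N by rewrite ji.
apply/eqP; rewrite eqn_leq len_tperm_lt // andbT.
have sub : ordered_move (tperm i j) @: (inversions (tperm i j * w) :\ (i, j)) \subset inversions w.
  apply/subsetP => q /imsetP [[c d]]; rewrite !inE /= !permM xpair_eqE -!val_eqE => /and3P [ne cd wdc] ->.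
  suff h : (tperm i j c < tperm i j d)%N by rewrite /ordered_move /= h /= h.
  move: ne cd; case: tpermP => [->|->|/eqP + /eqP +]; case: tpermP => [->|->|/eqP + /eqP +];
    rewrite -?val_eqE /=; lia.
have := subset_leq_card sub; rewrite card_in_imset; last first.
  by apply: sub_in2 (@ordered_move_inj i j) => p; rewrite !inE => /and3P [].
have : (i, j) \in inversions (tperm i j * w).
  by rewrite inE /= ij !permM tpermL tpermR wij.
by rewrite !lenE (cardsD1 (i, j) (inversions (_ * _))) => ->.
Qed.

(** An edge is defined by a transposition of values; conjugating it by [w] gives an exchange of
    positions, for which the length condition becomes [w i < w j]. *)
Lemma bedgeP w w' :
  reflect (exists i j, [/\ (i < j)%N, (w i < w j)%N & w' = tperm i j * w]) (bedge w w').
Proof.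
apply: (iffP andP).
  case=> /existsP [t /andP [/existsP [k /existsP [l /andP [kl /eqP ->]]] /eqP e]] h.
  have e' : w' = tperm (w^-1 k) (w^-1 l) * w by rewrite e /Defs.comp -tpermJ conjgE invgK mulgA mulgKV.
  have : w^-1 k != w^-1 l by rewrite (inj_eq perm_inj).
  move: e' h; move: (w^-1 k) (w^-1 l) => i j -> h; rewrite -val_eqE neq_ltn /= => /orP [ij|ji].
    by exists i, j; rewrite -len_tperm_gtE.
  by exists j, i; rewrite -len_tperm_gtE // tpermC.
case=> i [j [ij wij ->]]; split; last exact: len_tperm_lt.
apply/existsP; exists (tperm (w i) (w j)); apply/andP; split.
  apply/existsP; exists (w i); apply/existsP; exists (w j).
  by rewrite eqxx andbT (inj_eq perm_inj) -val_eqE neq_ltn /= ij.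
by rewrite /Defs.comp -tpermJ -conjgC.
Qed.

End Length.

(** * Bruhat order as comparison of the counts [rank] *)

Section Rank.
Variable n : nat.
Implicit Types (u v w x : 'S_n) (i j a b c m : 'I_n) (p q k : nat).
Local Open Scope group_scope.

Definition rank w p k : nat := \sum_(c < n) ((c < p) && (k <= w c))%N.
Definition rank_le u v := forall p k, (rank u p k <= rank v p k)%N.

(* u and v have the values above m in the same places. *)
Definition agree_above (m : nat) u v :=
  forall c k, (m < k)%N -> (k <= u c)%N = (k <= v c)%N.

Lemma rank_tperm w i j p k : (i < j)%N -> (w i < w j)%N ->
  rank (tperm i j * w) p k = (rank w p k + ((i < p <= j) && (w i < k <= w j)))%N.
Proof.
move=> ij wij; have ji : j != i by rewrite -val_eqE neq_ltn ij orbT.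
rewrite /rank !(bigD1 (P := predT) i) //= !(bigD1 (P := predC1 i) j) //=.
rewrite !permM tpermL tpermR (eq_bigr (fun c => ((c < p) && (k <= w c))%N : nat)); first by lia.
by move=> c /andP [ci cj]; rewrite permM tpermD // eq_sym.
Qed.

Lemma rank_split w p q k : (p <= q)%N ->
  rank w q k = (rank w p k + \sum_(c < n | p <= c < q) (k <= w c))%N.
Proof.
move=> pq; rewrite /rank [X in (_ + X)%N]big_mkcond -big_split; apply: eq_bigr => c _ /=.
by case: ifP; lia.
Qed.

Lemma rank_succ w c k : rank w c.+1 k = (rank w c k + (k <= w c))%N.
Proof.
rewrite (@rank_split w c c.+1) // (bigD1 c) /=; last by rewrite leqnn ltnS leqnn.
rewrite big1 ?addn0 // => d /andP [h]; rewrite -val_eqE /=; lia.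
Qed.

Lemma rank_value w p m : rank w p m = (rank w p m.+1 + (w^-1 m < p))%N.
Proof.
rewrite /rank (bigD1 (w^-1 m)) //= [in RHS](bigD1 (w^-1 m)) //= permKV leqnn ltnn andbT andbF add0n addnC.
congr (_ + _)%N; apply: eq_bigr => c; rewrite -(inj_eq (@perm_inj _ w)) permKV -val_eqE /= => h.
lia.
Qed.

Lemma rank_le_refl u : rank_le u u. Proof. by move=> p k. Qed.

Lemma rank_le_trans v u w : rank_le u v -> rank_le v w -> rank_le u w.
Proof. by move=> h1 h2 p k; apply: leq_trans (h1 p k) (h2 p k). Qed.

Lemma rank_le_bedge u v : bedge u v -> rank_le u v.
Proof. by move=> /bedgeP [i [j [ij uij ->]]] p k; rewrite rank_tperm // leq_addr. Qed.

Lemma bruhat_rank_le u v : bruhat u v -> rank_le u v.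
Proof.
move=> /connectP [s]; elim: s u => [|y s IH] u /=; first by move=> _ ->.
move=> /andP [uy ys] e; exact: rank_le_trans (rank_le_bedge uy) (IH _ ys e).
Qed.

Lemma rank_agree m u v p k : agree_above m u v -> (m < k)%N -> rank u p k = rank v p k.
Proof. by move=> A mk; apply: eq_bigr => c _; rewrite A. Qed.

Lemma agree_above_sym m u v : agree_above m u v -> agree_above m v u.
Proof. by move=> A c k h; rewrite A. Qed.

Lemma agree_above_trans m v u w : agree_above m u v -> agree_above m v w -> agree_above m u w.
Proof. by move=> A B c k h; rewrite A // B. Qed.

Lemma agree_above_mulg m (s : 'S_n) u v : agree_above m u v -> agree_above m (s * u) (s * v).
Proof. by move=> A c k h; rewrite !permM A. Qed.

(** Above level [m] the counts of [u] and [v] coincide, so those of [x] are squeezed to the same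
    numbers; differences of counts at consecutive positions recover the comparisons [k <= x c]. *)
Lemma agree_above_squeeze m u x v :
  rank_le u x -> rank_le x v -> agree_above m u v -> agree_above m u x.
Proof.
move=> ux xv A c k mk.
have E p : rank u p k = rank x p k.
  by have := ux p k; have := xv p k; rewrite (rank_agree p A mk); lia.
have := rank_succ u c k; rewrite !E rank_succ.
by case: (_ <= _)%N; case: (_ <= _)%N => //; lia.
Qed.

Lemma agree_above_le m u v c : agree_above m u v -> (u c <= m)%N -> (v c <= m)%N.
Proof. by move=> A; rewrite leqNgt A // -leqNgt. Qed.

(** Between levels [m] and [m.+1] a count changes only by whether [m] has been met; the counts at
    level [m.+1] agree, so at [a.+1] the permutation [v] must have met [m] too. *)
Lemma position_antitone m a b u v :
  agree_above m u v -> rank_le u v -> u a = m -> v b = m -> (b <= a)%N.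
Proof.
move=> A uv ua vb; have := uv a.+1 m.
have -> : a = u^-1 m by rewrite -ua permK.
have -> : b = v^-1 m by rewrite -vb permK.
rewrite !rank_value (rank_agree _ A (ltnSn m)); lia.
Qed.

(* Among the positions in (b, a], let c carry the largest value below m = v b; moving m
   from b to c loses no x <= v that carries m at position a. *)
Lemma rank_step_down m a b v : v b = m -> (b < a)%N -> (v a <= m)%N ->
  exists c, [/\ (b < c <= a)%N, (v c < m)%N &
    forall x, rank_le x v -> agree_above m x v -> x a = m -> rank_le x (tperm b c * v)].
Proof.
move=> vb ba va.
have va' : (v a < m)%N.
  rewrite ltn_neqAle va andbT val_eqE -vb (inj_eq perm_inj) -val_eqE /=; lia.
have Pa : (b < a <= a)%N && (v a < m)%N by rewrite ba leqnn va'.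
pose c := [arg max_(c > a | (b < c <= a)%N && (v c < m)%N) (v c : nat)].
exists c; rewrite /c; case: arg_maxnP => // {}c /andP [bca vcm] cmax.
split=> // x xv A xa p k.
have [bc ca] : (b < c)%N /\ (c <= a)%N by apply/andP.
pose v' := tperm b c * v.
have ev : v = tperm b c * v' by rewrite /v' mulgA tperm2 mul1g.
have := @rank_tperm v' b c p k bc; rewrite -ev /v' !permM tpermL tpermR vb => /(_ vcm).
case: (boolP (_ && _)) => [|_]; last by rewrite addn0 => <-.
move=> /andP [/andP [bp pc] /andP [vk km]] rv.
(* Strictness on the rectangle that the exchange loses comes from comparing at [a.+1]. From [p] to
   [a], maximality of [v c] leaves no value of [v] between [k] and [m], whereas [x] has [m] at [a];
   above [m] the counts of [x] and [v] agree. *)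
suff : (rank x p k < rank v p k)%N by rewrite -/v' in rv *; lia.
have pa : (p <= a.+1)%N by lia.
have rvk := rank_split v k pa; have rxk := rank_split x k pa.
have rvm := rank_split v m.+1 pa; have rxm := rank_split x m.+1 pa.
have E1 : \sum_(d < n | p <= d < a.+1) (k <= v d)%N = \sum_(d < n | p <= d < a.+1) (m.+1 <= v d)%N.
  apply: eq_bigr => d /andP [pd da]; congr nat_of_bool; apply/idP/idP; last by lia.
  move=> kd; rewrite ltnNge; apply/negP => dm.
  have dm' : (v d < m)%N.
    rewrite ltn_neqAle dm andbT val_eqE -vb (inj_eq perm_inj) -val_eqE /=; lia.
  have : (b < d <= a)%N && (v d < m)%N by rewrite dm'; lia.
  by move=> /cmax; lia.
have E2 : (\sum_(d < n | p <= d < a.+1) (m.+1 <= x d) < \sum_(d < n | p <= d < a.+1) (k <= x d))%N.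
  have Qa : (p <= a < a.+1)%N by lia.
  rewrite (bigD1 a) //= [X in (_ < X)%N](bigD1 a) //= xa km ltnn add0n add1n ltnS.
  by apply: leq_sum => d _; lia.
have := xv a.+1 k.
have := rank_agree p A (ltnSn m); have := rank_agree a.+1 A (ltnSn m); lia.
Qed.

(** Each application of [rank_step_down] moves [m] to the right without losing any candidate [x];
    once [m] stands at [a], the permutation reached is itself the greatest candidate. *)
Lemma rank_max_at m a b v : v b = m -> (b <= a)%N -> (v a <= m)%N ->
  exists z, [/\ rank_le z v, z a = m &
    forall x, rank_le x v -> agree_above m x v -> x a = m -> rank_le x z].
Proof.
have [N] := ubnP (a - b); elim: N v b => // N IH v b; rewrite ltnS => lN vb.
rewrite leq_eqVlt => /orP [/eqP/val_inj e _|ba va].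
  by exists v; split; [exact: rank_le_refl|rewrite -e|].
have [c [/andP [bc ca] vcm h]] := rank_step_down vb ba va.
set v' := tperm b c * v in h.
have e : bedge v' v.
  apply/bedgeP; exists b, c; split=> //; last by rewrite /v' mulgA tperm2 mul1g.
  by rewrite /v' !permM tpermL tpermR vb.
have A : agree_above m v v'.
  by move=> d k mk; rewrite permM; case: tpermP => [->|->|//]; rewrite vb; lia.
have [||||z [zv' za zm]] := IH v' c.
- by apply: leq_trans lN; lia.
- by rewrite permM tpermR.
- exact: ca.
- exact: agree_above_le A va.
exists z; split=> //; first exact: rank_le_trans zv' (rank_le_bedge e).
move=> x xv ag xa; apply: zm => //; first exact: h.
exact: agree_above_trans ag A.
Qed.

Lemma max_disagreement u v : u != v ->
  exists m, agree_above m u v /\ u^-1 m != v^-1 m.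
Proof.
move=> uv; have [c0 hc0] : exists c, u^-1 c != v^-1 c.
  apply/existsP; rewrite -negb_forall; apply: contra uv => /forallP h.
  by apply/eqP/invg_inj/permP => c; apply/eqP.
pose P c := u^-1 c != v^-1 c.
pose m := [arg max_(c > c0 | P c) (c : nat)].
exists m; rewrite /m; case: arg_maxnP => // {}m Pm mmax; split=> //.
have half (f g : 'S_n) c k : (forall d, P d = (f^-1 d != g^-1 d)) -> (m < k)%N -> (k <= f c)%N -> (k <= g c)%N.
  move=> hP mk kf; case: (boolP (P (f c))) => [/mmax|]; first by lia.
  by rewrite hP negbK permK => /eqP ->; rewrite permKV.
move=> c k mk; apply/idP/idP; apply: half => // d.
by rewrite /P eq_sym.
Qed.

(** At the largest disagreement [m], the permutation [u] is itself one of the candidates [x] of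
    [rank_step_down], so [v] can be lowered along an edge while remaining above [u]. *)
Lemma rank_le_bruhat u v : rank_le u v -> bruhat u v.
Proof.
have [N] := ubnP (len v); elim: N v => // N IH v; rewrite ltnS => lN uv.
have [->|/max_disagreement [m [A ne]]] := eqVneq u v; first exact: connect0.
have ba : (v^-1 m < u^-1 m)%N.
  have := position_antitone A uv (permKV u m) (permKV v m).
  by rewrite leq_eqVlt eq_sym val_eqE (negPf ne).
have va : (v (u^-1 m) <= m)%N by apply: (agree_above_le A); rewrite permKV.
have [c [/andP [bc ca] vcm /(_ u uv A (permKV u m)) ux]] := rank_step_down (permKV v m) ba va.
set b := v^-1 m in bc ux *.
have e : bedge (tperm b c * v) v.
  apply/bedgeP; exists b, c; split=> //; last by rewrite mulgA tperm2 mul1g.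
  by rewrite !permM tpermL tpermR permKV.
apply: connect_trans (connect1 e); apply: IH => //.
by apply: leq_trans lN; case/andP: e.
Qed.

Lemma bruhatP u v : reflect (rank_le u v) (bruhat u v).
Proof. apply: (iffP idP); [exact: bruhat_rank_le | exact: rank_le_bruhat]. Qed.

Lemma rank_le_len u v : rank_le u v -> (len u <= len v)%N.
Proof.
move=> /rank_le_bruhat /connectP [s]; elim: s u => [|y s IH] u /=; first by move=> _ ->.
by move=> /andP [/andP [_ /ltnW uy] ys] e; apply: leq_trans uy (IH _ ys e).
Qed.

Lemma rank_le_len_lt u v : rank_le u v -> u != v -> (len u < len v)%N.
Proof.
move=> /rank_le_bruhat /connectP [[|y s] /= ys e]; first by rewrite e eqxx.
move: ys => /andP [/andP [_ uy] ys] _; apply: leq_trans uy _.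
by apply/rank_le_len/bruhatP/connectP; exists s.
Qed.

End Rank.

(** * Tilde R-polynomials through the Hecke algebra *)

Section RPolynomials.
Import GRing.Theory Num.Theory.
Variable n : nat.
Implicit Types (u v w x : 'S_n) (i j k l : 'I_n) (f : {ffun 'S_n -> {poly int}}).
Local Open Scope ring_scope.

(* Right multiplication by T_s + q, with s = (i j), on the Hecke module normalised by
   T_s ^ 2 = 1 - q T_s; f lists the coefficients on the basis T_u. *)
Definition hecke_op i j f : {ffun 'S_n -> {poly int}} :=
  [ffun u => f (tperm i j * u)%g + (if (u i < u j)%N then 'X * f u else 0)].

Lemma tpermKg i j u : (tperm i j * (tperm i j * u) = u)%g.
Proof. by rewrite mulgA tperm2 mul1g. Qed.

Lemma hecke_op_comm i j k l f : i != k -> i != l -> j != k -> j != l ->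
  hecke_op i j (hecke_op k l f) = hecke_op k l (hecke_op i j f).
Proof.
move=> ik il jk jl; apply/ffunP => u; rewrite !ffunE !permM.
rewrite ![tperm i j _]tpermD // ![tperm k l _]tpermD 1?eq_sym // !mulgA.
rewrite (_ : tperm k l * tperm i j = tperm i j * tperm k l)%g; first by do 2! case: ifP => _; ring.
rewrite conjgC; congr (_ * _)%g; rewrite tpermJ !tpermD //; by rewrite eq_sym.
Qed.

Lemma hecke_op_braid i j k f : (i < j)%N -> (j < k)%N ->
  hecke_op i j (hecke_op j k (hecke_op i j f)) = hecke_op j k (hecke_op i j (hecke_op j k f)).
Proof.
move=> ij jk; have [nij njk nik] : [/\ i != j, j != k & i != k].
  by rewrite -!val_eqE /=; split; lia.
have sk : tperm i j k = k by rewrite tpermD.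
have ti : tperm j k i = i by rewrite tpermD // eq_sym.
have braid u : (tperm i j * (tperm j k * (tperm i j * u)) = tperm j k * (tperm i j * (tperm j k * u)))%g.
  rewrite !mulgA; congr (_ * _)%g.
  have := tpermJ j k (tperm i j); have := tpermJ i j (tperm j k).
  by rewrite !conjgE !tpermV sk ti !tpermL !tpermR !mulgA => -> ->.
apply/ffunP => u.
have [uij ujk uik] : [/\ u i != u j :> nat, u j != u k :> nat & u i != u k :> nat].
  by rewrite !val_eqE !(inj_eq perm_inj).
rewrite !ffunE !permM !(sk, ti, tpermL, tpermR, tpermKg) braid.
by case: (ltngtP (u i) (u j)) uij => // h1 _; case: (ltngtP (u j) (u k)) ujk => // h2 _;
  case: (ltngtP (u i) (u k)) uik => // h3 _; (try by exfalso; lia); ring.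
Qed.

Lemma compE w (s : 'S_n) : Defs.comp w s = (s * w)%g. Proof. by []. Qed.

Lemma pick_descP v : 
  match pick_desc v with
  | Some p => (p.2 = p.1.+1 :> nat) /\ (v p.2 < v p.1)%N
  | None => forall i j, j = i.+1 :> nat -> ~~ (v j < v i)%N
  end.
Proof.
rewrite /pick_desc; case: pickP => [p|h].
  move=> /andP [/eqP e]; rewrite /rdesc compE len_tperm_ltE //.
  by rewrite e.
move=> i j e; have := h (i, j); rewrite /rdesc compE len_tperm_ltE /= ?e //.
by rewrite eqxx /= => ->.
Qed.

(** Descents are chosen by [pick_desc] exactly as in [Rfuel], so that the two recursions run in
    parallel. *)
Fixpoint rtilde_rec (d : nat) v : {ffun 'S_n -> {poly int}} :=
  match d, pick_desc v with
  | d'.+1, Some p => hecke_op p.1 p.2 (rtilde_rec d' (tperm p.1 p.2 * v)%g)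
  | _, _ => [ffun u => (u == v)%:R]
  end.

Definition rtilde v := rtilde_rec (len v) v.

Lemma len_descent v i j : (j = i.+1 :> nat) -> (v j < v i)%N ->
  len v = (len (tperm i j * v)%g).+1.
Proof.
move=> ji vji; rewrite -{1}(tpermKg i j v) len_adjacent //.
by rewrite !permM tpermL tpermR.
Qed.

Lemma rtilde_pick v : rtilde v =
  if pick_desc v is Some p then hecke_op p.1 p.2 (rtilde (tperm p.1 p.2 * v)%g)
  else [ffun u => (u == v)%:R].
Proof.
rewrite {1}/rtilde; have := pick_descP v; case e: (pick_desc v) => [p|] h.
  by case: h => h1 h2; rewrite (len_descent h1 h2) /= e.
by case: (len v) => [|d] //=; rewrite e.
Qed.

(** The given descent and the picked one coincide, commute, or are adjacent. In the adjacent case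
    [v] decreases along three consecutive positions, and unfolding three factors on each side leaves
    the two sides of the braid relation. *)
Lemma rtilde_descent v i j : (j = i.+1 :> nat) -> (v j < v i)%N ->
  rtilde v = hecke_op i j (rtilde (tperm i j * v)%g).
Proof.
have [N] := ubnP (len v); elim: N v i j => // N IH v i j; rewrite ltnS => lN ji vji.
have braid (a b c : 'I_n) : (b = a.+1 :> nat) -> (c = b.+1 :> nat) -> (v b < v a)%N -> (v c < v b)%N ->
    hecke_op a b (rtilde (tperm a b * v)%g) = hecke_op b c (rtilde (tperm b c * v)%g).
  move=> ba cb vba vcb.
  have [nab nbc nac] : [/\ a != b, b != c & a != c] by rewrite -!val_eqE /=; split; lia.
  have sc : tperm a b c = c by rewrite tpermD.
  have ta : tperm b c a = a by rewrite tpermD // eq_sym.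
  have L1 := len_descent ba vba; have L2 := len_descent cb vcb.
  have d1 : ((tperm a b * v)%g c < (tperm a b * v)%g b)%N by rewrite !permM sc tpermR; apply: ltn_trans vcb vba.
  have d2 : ((tperm b c * v)%g b < (tperm b c * v)%g a)%N by rewrite !permM ta tpermL; apply: ltn_trans vcb vba.
  have L3 := len_descent cb d1; have L4 := len_descent ba d2.
  rewrite (IH (tperm a b * v)%g b c) //; last by lia.
  rewrite (IH (tperm b c * v)%g a b) //; last by lia.
  rewrite (IH (tperm b c * (tperm a b * v))%g a b) //; [|lia|by rewrite !permM !(sc, ta, tpermL, tpermR)].
  rewrite (IH (tperm a b * (tperm b c * v))%g b c) //; [|lia|by rewrite !permM !(sc, ta, tpermL, tpermR)].
  rewrite hecke_op_braid; [|lia|lia]; congr (hecke_op _ _ (hecke_op _ _ (hecke_op _ _ (rtilde _)))).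
  rewrite !mulgA; congr (_ * _)%g.
  have := tpermJ b c (tperm a b); have := tpermJ a b (tperm b c).
  by rewrite !conjgE !tpermV sc ta !tpermL !tpermR !mulgA => -> ->.
rewrite rtilde_pick; have := pick_descP v; case: (pick_desc v) => [[k l] /= [lk vlk]|]; last first.
  by move=> /(_ _ _ ji); rewrite vji.
have [ik|nik] := eqVneq i k.
  have jl : j = l by apply: val_inj; rewrite /= ji lk ik.
  by rewrite ik jl.
have [jk|njk] := eqVneq j k.
  by apply/esym; rewrite -jk in lk vlk *; apply: braid.
have [il|nil] := eqVneq i l.
  by rewrite -il in lk vlk *; apply: braid.
have njl : j != l by move: nik; rewrite -!val_eqE /=; lia.
have e1 : rtilde (tperm k l * v)%g = hecke_op i j (rtilde (tperm i j * (tperm k l * v))%g).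
  apply: IH => //; first by have := len_descent lk vlk; lia.
  by rewrite !permM !tpermD // eq_sym.
have e2 : rtilde (tperm i j * v)%g = hecke_op k l (rtilde (tperm k l * (tperm i j * v))%g).
  apply: IH => //; first by have := len_descent ji vji; lia.
  by rewrite !permM !tpermD // eq_sym.
rewrite e1 e2 hecke_op_comm 1?eq_sym //; congr (hecke_op _ _ (hecke_op _ _ (rtilde _))).
rewrite !mulgA; congr (_ * _)%g.
rewrite conjgC; congr (_ * _)%g; rewrite tpermJ !tpermD //; by rewrite eq_sym.
Qed.

Lemma rtilde_descents u v i j : (j = i.+1 :> nat) -> (v j < v i)%N -> (u j < u i)%N ->
  rtilde v u = rtilde (tperm i j * v)%g (tperm i j * u)%g.
Proof.
by move=> ji vji uji; rewrite (rtilde_descent ji vji) ffunE ltnNge (ltnW uji) addr0.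
Qed.

Lemma rtilde_ascent u v i j : (j = i.+1 :> nat) -> (v j < v i)%N -> (u i < u j)%N ->
  rtilde v u = rtilde (tperm i j * v)%g (tperm i j * u)%g + 'X * rtilde (tperm i j * v)%g u.
Proof.
by move=> ji vji uij; rewrite (rtilde_descent ji vji) ffunE uij.
Qed.

Lemma rtilde_refl v : rtilde v v = 1.
Proof.
have [N] := ubnP (len v); elim: N v => // N IH v; rewrite ltnS => lN.
rewrite rtilde_pick; have := pick_descP v; case: (pick_desc v) => [[k l] /= [lk vlk]|_]; last first.
  by rewrite ffunE eqxx.
rewrite ffunE ltnNge (ltnW vlk) addr0 IH //.
by have := len_descent lk vlk; lia.
Qed.

Lemma rank_tperm_adjacent u i j p q : (j = i.+1 :> nat) -> p != j :> nat ->
  rank (tperm i j * u)%g p q = rank u p q.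
Proof.
move=> ji; have ij : (i < j)%N by lia.
have [h|h|/val_inj/perm_inj e] := ltngtP (u i) (u j); last by move: ij; rewrite e ltnn.
  by rewrite rank_tperm //; lia.
have := @rank_tperm _ (tperm i j * u)%g i j p q ij.
by rewrite !permM tpermL tpermR tpermKg => /(_ h); lia.
Qed.

(** The exchange affects only the counts at [j]. There, the counts at [i] suffice unless [u i]
    reaches level [q] and [v i] does not; then [v j] does not either, and the counts at [j.+1]
    decide. *)
Lemma rank_le_lift u v i j : (j = i.+1 :> nat) -> (v j < v i)%N -> (u j < u i)%N ->
  rank_le (tperm i j * u)%g (tperm i j * v)%g -> rank_le u v.
Proof.
move=> ji vji uji uv p q.
have E p' : p' != j :> nat -> (rank u p' q <= rank v p' q)%N.
  by move=> pj; have := uv p' q; rewrite !rank_tperm_adjacent.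
have [e|/E //] := eqVneq p j.
have := E i; have := E j.+1; rewrite !rank_succ e ji !rank_succ.
by case: (leqP q (u i)); case: (leqP q (u j)); case: (leqP q (v i)); case: (leqP q (v j)) => /=; lia.
Qed.

Lemma rank_le_ascent u i j : (j = i.+1 :> nat) -> (u i < u j)%N -> rank_le u (tperm i j * u)%g.
Proof. by move=> ji uij p q; rewrite rank_tperm ?ji // leq_addr. Qed.

Lemma rank_le_descent u i j : (j = i.+1 :> nat) -> (u j < u i)%N -> rank_le (tperm i j * u)%g u.
Proof.
move=> ji uji; have := @rank_le_ascent (tperm i j * u)%g i j ji.
by rewrite !permM tpermL tpermR tpermKg; apply.
Qed.

Lemma rtilde_eq0 u v : ~ rank_le u v -> rtilde v u = 0.
Proof.
have [N] := ubnP (len v); elim: N u v => // N IH u v; rewrite ltnS => lN nuv.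
rewrite rtilde_pick; have := pick_descP v; case: (pick_desc v) => [[k l] /= [lk vlk]|_]; last first.
  by rewrite ffunE; case: eqP => // e; case: nuv; rewrite e; apply: rank_le_refl.
have L := len_descent lk vlk.
have sv := rank_le_descent lk vlk.
rewrite ffunE; have [h|h|/val_inj/perm_inj e] := ltngtP (u k) (u l); last by move: lk; rewrite e; lia.
  rewrite !IH ?mulr0 ?addr0 //; try lia.
    by move=> H; apply: nuv; apply: rank_le_trans H sv.
  move=> H; apply: nuv; apply: rank_le_trans sv.
  exact: rank_le_trans (rank_le_ascent lk h) H.
rewrite IH ?addr0 //; first lia.
by move=> H; apply: nuv; apply: rank_le_lift H.
Qed.

Lemma isRtilde0 (d : nat) : @isRtilde 0 d 0.
Proof. by move=> t _; rewrite rmorph0 !horner0 mulr0. Qed.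

Lemma isRtilde_mulX P (d : nat) p : isRtilde P d p -> isRtilde ('X * P) d.+2 p.
Proof.
move=> h t t0; rewrite rmorphM /= map_polyX hornerM hornerX h // !exprS; ring.
Qed.

(** With q = t^2 one has q - 1 = t (t - t^-1), whose second factor becomes ['X] on the tilde side.
    The first hypothesis concerns ['X * P1] because its exponent is obtained differently according
    to whether the tilde polynomial vanishes. *)
Lemma isRtilde_ascent P1 P2 (d : nat) p1 p2 :
  isRtilde ('X * P1) d.+1 p1 -> isRtilde P2 d p2 ->
  isRtilde ('X * P1 + ('X - 1) * P2) d.+1 (p1 + 'X * p2).
Proof.
move=> h1 h2 t t0; rewrite rmorphD /= hornerD h1 // rmorphM rmorphB /= rmorph1 map_polyX.
rewrite hornerM hornerD hornerN hornerX hornerC h2 // rmorphD rmorphM /= map_polyX.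
by rewrite hornerD hornerM hornerX exprS; field.
Qed.

Lemma isRtilde_Rfuel u v : isRtilde (Rfuel (len v) u v) (len v - len u) (rtilde v u).
Proof.
have [N] := ubnP (len v); elim: N u v => // N IH u v; rewrite ltnS => lN.
have [/bruhatP uv|nuv] := boolP (bruhat u v); last first.
  rewrite rtilde_eq0; last by move=> /bruhatP; apply/negP.
  case: (len v) => [|d] /=; last by rewrite nuv; apply: isRtilde0.
  case: eqP => [e|_]; last exact: isRtilde0.
  by move: nuv; rewrite e /bruhat connect0.
have [<-|ne] := eqVneq u v.
  rewrite rtilde_refl subnn.
  have -> : Rfuel (len u) u u = 1 by case: (len u) => [|d] /=; rewrite ?eqxx // /bruhat connect0.
  by move=> t _; rewrite rmorph1 !hornerC expr0 mul1r.
rewrite rtilde_pick; have := pick_descP v; case e: (pick_desc v) => [[k l] /= |]; last first.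
  move=> _; rewrite ffunE (negPf ne).
  by case: (len v) => [|d] /=; rewrite ?e (negPf ne) ?(introT (bruhatP _ _) uv); exact: isRtilde0.
move=> [lk vlk]; rewrite (len_descent lk vlk) /= e (negPf ne) (introT (bruhatP _ _) uv) /=.
have kl : (k < l)%N by lia.
rewrite /rdesc !compE len_tperm_ltE // ffunE.
have L := len_descent lk vlk.
have I1 := IH (tperm k l * u)%g (tperm k l * v)%g ltac:(lia).
have I2 := IH u (tperm k l * v)%g ltac:(lia).
have [h|h|/val_inj/perm_inj h] := ltngtP (u k) (u l); last by move: kl; rewrite h ltnn.
  have L' := len_adjacent lk h.
  have Luv := rank_le_len_lt uv ne.
  rewrite (_ : (_ - len u)%N = (len (tperm k l * v)%g - len u).+1); last by lia.
  apply: isRtilde_ascent => //.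
  (* Length differences are truncated at 0, so the exponent is the expected one only if the two
     permutations are comparable; otherwise the tilde polynomial is 0 and any exponent fits. *)
  have [le|nle] := boolP (bruhat (tperm k l * u)%g (tperm k l * v)%g).
    have le' := rank_le_len (elimT (bruhatP _ _) le).
    rewrite (_ : (_ - len u).+1 = (len (tperm k l * v)%g - len (tperm k l * u)%g).+2)%N; last by lia.
    exact: isRtilde_mulX.
  move: I1; rewrite rtilde_eq0; last by move=> /bruhatP; apply/negP.
  move=> /isRtilde_mulX I1 t t0; move: (I1 t t0); rewrite !rmorph0 !horner0 !mulr0 => ->; ring.
by rewrite addr0; have L' := len_descent lk h; rewrite L' subSS.
Qed.

Lemma isRtilde_uniq P (d : nat) p p' : isRtilde P d p -> isRtilde P d p' -> p = p'.
Proof.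
move=> h h'; apply: (@map_inj_poly _ _ (fun z : int => z%:~R : rat)) => //; first exact: intr_inj.
apply/eqP; rewrite -subr_eq0; set q := (_ - _ : {poly rat}).
(* Evaluating at t = 1, ..., [size q] gives too many roots t - t^-1 for a nonzero [q]; they are
   distinct because their differences factor as (k - l)(1 + 1/(kl)). *)
pose s := [seq k.+1%:R - k.+1%:R^-1 : rat | k : nat <- iota 0 (size q)].
have q0 (t : rat) : t != 0 -> root q (t - t^-1).
  move=> t0; rewrite rootE /q hornerD hornerN subr_eq0; apply/eqP.
  by apply: (@mulfI _ (t ^+ d)); rewrite ?expf_eq0 ?(negPf t0) ?andbF // -h // -h'.
apply: contraT => nq; have := @max_poly_roots _ q s nq.
rewrite size_map size_iota ltnn; apply.
  by apply/allP => _ /mapP [k _ ->]; apply: q0; rewrite pnatr_eq0.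
rewrite map_inj_in_uniq ?iota_uniq // => k l _ _ e.
have [k0 l0] : (k.+1%:R : rat) != 0 /\ (l.+1%:R : rat) != 0 by rewrite !pnatr_eq0.
have : (k.+1%:R - l.+1%:R) * (1 + (k.+1%:R * l.+1%:R)^-1) = 0 :> rat.
  have E (a b : rat) : a != 0 -> b != 0 -> (a - b) * (1 + (a * b)^-1) = (a - a^-1) - (b - b^-1).
    by move=> a0 b0; field; rewrite a0 b0.
  by rewrite E // e subrr.
move=> /eqP; rewrite mulf_eq0 => /orP [|].
  by rewrite subr_eq0 eqr_nat eqSS => /eqP.
by rewrite -natrM Order.POrderTheory.gt_eqF // ltr_wpDr // invr_ge0 ler0n.
Qed.

Lemma Rtilde_rtilde u v : Rtilde u v = rtilde v u.
Proof.
apply: (@isRtilde_uniq (Rpoly u v) (len v - len u)); last exact: isRtilde_Rfuel.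
by apply: epsilon_spec; exists (rtilde v u); apply: isRtilde_Rfuel.
Qed.

End RPolynomials.

(** * Cycles through a set of positions, and the rotations they induce *)

Section ShiftCycle.
Variables (n : nat) (a : 'I_n).
Implicit Types (x v : 'S_n) (i j b c d l : 'I_n) (s : seq 'I_n) (A : {set 'I_n}).
Local Open Scope group_scope.

Definition ord_lt : rel 'I_n := fun i j => (i < j)%N.

Lemma ord_lt_trans : transitive ord_lt.
Proof. by move=> j i k; apply: ltn_trans. Qed.

Lemma enum_sorted A : sorted ord_lt (enum A).
Proof.
rewrite {1}/(enum _) -enumT; apply: sorted_filter; first exact: ord_lt_trans.
have : sorted ltn (map val (enum 'I_n)) by rewrite val_enum_ord iota_ltn_sorted.
by rewrite sorted_map.
Qed.

Lemma eq_enum_sorted A s : sorted ord_lt s -> s =i A -> enum A = s.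
Proof.
move=> ss sA; apply: (irr_sorted_eq ord_lt_trans) => //.
- by move=> i; apply: ltnn.
- exact: enum_sorted.
by move=> i; rewrite mem_enum sA.
Qed.

Definition shift_cycle_seq s := \prod_(i <- s) tperm i a.
(* The cycle through A and a sending each element of A to the next one and a to the
   smallest. *)
Definition shift_cycle A := shift_cycle_seq (enum A).

Lemma shift_cycle_seq_id s c : c \notin s -> c != a -> shift_cycle_seq s c = c.
Proof.
elim: s => [|i s IH]; first by rewrite /shift_cycle_seq big_nil perm1.
rewrite in_cons negb_or => /andP [ci cs] ca; rewrite /shift_cycle_seq big_cons permM.
by rewrite tpermD ?IH // eq_sym.
Qed.

Lemma shift_cycle_seq_head s : a \notin s -> uniq s -> shift_cycle_seq s a = head a s.
Proof.
case: s => [|i s]; first by rewrite /shift_cycle_seq big_nil perm1.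
rewrite in_cons negb_or => /andP [ai _] /= /andP [si _].
rewrite /shift_cycle_seq big_cons permM tpermR; apply: shift_cycle_seq_id => //.
by rewrite eq_sym.
Qed.

Definition below A := forall i, i \in A -> (i < a)%N.

Lemma below_notin A : below A -> a \notin A.
Proof. by move=> B; apply/negP => /B; rewrite ltnn. Qed.

Lemma shift_cycle_id A c : c \notin A -> c != a -> shift_cycle A c = c.
Proof. by move=> cA ca; apply: shift_cycle_seq_id; rewrite ?mem_enum. Qed.

Lemma shift_cycleV_id A c : c \notin A -> c != a -> (shift_cycle A)^-1 c = c.
Proof. by move=> cA ca; rewrite -{1}(shift_cycle_id cA ca) permK. Qed.

Lemma shift_cycle0 : shift_cycle set0 = 1.
Proof. by rewrite /shift_cycle enum_set0 /shift_cycle_seq big_nil. Qed.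

Definition next_in A i c :=
  [/\ (i < c <= a)%N, c = a \/ c \in A & forall d, d \in A -> (i < d)%N -> (c <= d)%N].

Lemma next_in_uniq A i c c' : below A -> next_in A i c -> next_in A i c' -> c = c'.
Proof.
move=> B [/andP [ic ca] cA cm] [/andP [ic' ca'] cA' cm']; apply: val_inj; apply/eqP => /=.
rewrite eqn_leq; apply/andP; split.
  by case: cA' => [->|h] //; apply: cm.
by case: cA => [->|h] //; apply: cm'.
Qed.

(** In the product, the factor [tperm i a] stands before those of the elements above [i]. Moving it
    past them conjugates it by a cycle that fixes [i] and sends [a] to the smallest of these
    elements, or to [a] if there is none. *)
Lemma shift_cycle_split A i : below A -> i \notin A -> (i < a)%N ->
  exists2 c, next_in A i c & shift_cycle (i |: A) = shift_cycle A * tperm i c.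
Proof.
move=> B iA ia.
pose L := enum [set d in A | (d < i)%N]; pose R := enum [set d in A | (i < d)%N].
have aR : a \notin R by rewrite mem_enum inE (negPf (below_notin B)).
have iR : i \notin R by rewrite mem_enum inE (negPf iA).
have ia' : i != a by rewrite -val_eqE neq_ltn ia.
have sL : sorted ord_lt L := enum_sorted _; have sR : sorted ord_lt R := enum_sorted _.
have eA : enum A = L ++ R.
  apply: eq_enum_sorted.
    rewrite sorted_pairwise; last exact: ord_lt_trans.
    rewrite pairwise_cat -!sorted_pairwise; try exact: ord_lt_trans.
    rewrite sL sR !andbT; apply/allrelP => d e; rewrite !mem_enum !inE => /andP [_ h] /andP [_ h'].
    exact: ltn_trans h h'.
  move=> d; rewrite mem_cat !mem_enum !inE; case dA: (d \in A) => //=.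
  by rewrite -neq_ltn val_eqE; apply: contraNneq iA => <-.
have eiA : enum (i |: A) = L ++ i :: R.
  apply: eq_enum_sorted.
    rewrite sorted_pairwise; last exact: ord_lt_trans.
    rewrite pairwise_cat /= -!sorted_pairwise; try exact: ord_lt_trans.
    rewrite sL sR !andbT; apply/andP; split.
      apply/allrelP => d e; rewrite in_cons !mem_enum !inE => /andP [_ h] /orP [/eqP -> //|/andP [_ h']].
      exact: ltn_trans h h'.
    by apply/allP => d; rewrite mem_enum inE => /andP [].
  move=> d; rewrite mem_cat in_cons !mem_enum !inE.
  have [->|di] := eqVneq d i; first by rewrite orbT.
  case dA: (d \in A) => //=.
  by rewrite -neq_ltn val_eqE.
have ER d : (d \in R) = (d \in A) && (i < d)%N by rewrite mem_enum inE.
exists (head a R).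
  case: (R) ER sR => [|e s] ER /=.
    move=> _; split; [by rewrite ia leqnn|by left|].
    by move=> d dA id; have := ER d; rewrite dA id.
  rewrite path_sortedE; last exact: ord_lt_trans.
  move=> /andP [/allP h _]; have := ER e; rewrite mem_head => /esym /andP [eA' ie].
  split; [by rewrite ie ltnW ?B|by right|].
  move=> d dA id; have := ER d; rewrite dA id in_cons => /orP [/eqP -> //|/h /ltnW]; exact.
rewrite /shift_cycle eA eiA /shift_cycle_seq !big_cat big_cons /= -!mulgA; congr (_ * _).
rewrite conjgC -/(shift_cycle_seq R) tpermJ shift_cycle_seq_id // shift_cycle_seq_head //.
exact: enum_uniq.
Qed.

Lemma shift_cycle_insert A i c : below A -> i \notin A -> next_in A i c ->
  shift_cycle (i |: A) = shift_cycle A * tperm i c.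
Proof.
move=> B iA nc; have [ica _ _] := nc.
have [|c' nc' ->] := shift_cycle_split B iA; first by lia.
by rewrite (next_in_uniq B nc nc').
Qed.

Definition min_in A c := [/\ (c <= a)%N, c = a \/ c \in A & forall d, d \in A -> (c <= d)%N].

Lemma shift_cycle_min A : below A -> min_in A (shift_cycle A a).
Proof.
move=> B; rewrite /shift_cycle shift_cycle_seq_head ?enum_uniq ?mem_enum ?below_notin //.
have E d : (d \in enum A) = (d \in A) by rewrite mem_enum.
have := enum_sorted A; case: (enum A) E => [|d s] E /=.
  by split=> //; [left|move=> e; rewrite -E].
rewrite path_sortedE; last exact: ord_lt_trans.
move=> /andP [/allP h _]; have dA : d \in A by rewrite -E mem_head.
split; [exact/ltnW/B|by right|].
by move=> e; rewrite -E in_cons => /orP [/eqP -> //|/h /ltnW].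
Qed.

Lemma shift_cycle_conj A (t : 'S_n) : t a = a ->
  {in A &, forall i j, (i < j)%N -> (t i < t j)%N} -> shift_cycle (t @: A) = shift_cycle A ^ t.
Proof.
move=> ta tA; rewrite /shift_cycle.
rewrite (@eq_enum_sorted (t @: A) (map t (enum A))); last first.
- move=> i; apply/mapP/imsetP => -[j jA ->]; exists j => //; first by rewrite -mem_enum.
  by rewrite mem_enum.
- rewrite sorted_map; apply: (@sub_in_sorted _ (mem A)) (enum_sorted A) => //.
  by apply/allP => i; rewrite mem_enum.
rewrite /shift_cycle_seq big_map; elim: (enum A) => [|i s IH].
  by rewrite !big_nil conj1g.
by rewrite !big_cons conjMg tpermJ ta IH.
Qed.

(* If A carries a decreasing sequence of values of x below x a, this rotates the values
   along A and a so as to sort them decreasingly. *)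
Definition rotate x A := (shift_cycle A)^-1 * x.

Definition decreasing_below x A :=
  [forall i in A, (i < a)%N && (x i < x a)%N] &&
  [forall i in A, forall j in A, (i < j)%N ==> (x j < x i)%N].

Lemma decreasing_belowP x A :
  reflect [/\ below A, forall i, i \in A -> (x i < x a)%N &
    forall i j, i \in A -> j \in A -> (i < j)%N -> (x j < x i)%N] (decreasing_below x A).
Proof.
apply: (iffP andP) => [[/forall_inP h1 /forall_inP h2]|[h1 h2 h3]].
  split=> [i /h1 /andP [] //|i /h1 /andP [] //|i j /h2 /forall_inP h /h /implyP]; exact.
split; apply/forall_inP => i iA; first by rewrite h1 ?h2.
by apply/forall_inP => j jA; apply/implyP; apply: h3.
Qed.

Lemma decreasing_belowS x A A' : A \subset A' -> decreasing_below x A' -> decreasing_below x A.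
Proof.
move=> /subsetP s /decreasing_belowP [h1 h2 h3]; apply/decreasing_belowP; split.
- by move=> i /s /h1.
- by move=> i /s /h2.
by move=> i j /s iA /s; apply: h3.
Qed.

Lemma rotate0 x : rotate x set0 = x.
Proof. by rewrite /rotate shift_cycle0 invg1 mul1g. Qed.

Lemma rotate_id x A i : i \notin A -> i != a -> rotate x A i = x i.
Proof. by move=> iA ia; rewrite permM shift_cycleV_id. Qed.

Lemma rotate_insert x A i c : below A -> i \notin A -> next_in A i c ->
  rotate x (i |: A) = tperm i c * rotate x A.
Proof.
by move=> B iA nc; rewrite /rotate (shift_cycle_insert B iA nc) invMg tpermV mulgA.
Qed.

Lemma rotate1 x i : (i < a)%N -> rotate x [set i] = tperm i a * x.
Proof.
move=> ia; rewrite -(setU0 [set i]) (@rotate_insert _ _ _ a) ?rotate0 ?inE //.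
- by move=> j; rewrite inE.
- by split; [rewrite ia leqnn|left|move=> d; rewrite inE].
Qed.

(** Adding the elements from the largest down makes the successor of each new one the image of [a]
    under the cycle built so far. *)
Lemma set_min_ind (P : {set 'I_n} -> Prop) :
  P set0 -> (forall l A, l \notin A -> (forall i, i \in A -> (l < i)%N) -> P A -> P (l |: A)) ->
  forall A, P A.
Proof.
move=> P0 PS A; have [N] := ubnP #|A|; elim: N A => // N IH A; rewrite ltnS => cA.
have [->//|[l0 l0A]] := set_0Vmem A.
pose l := [arg min_(l < l0 in A) (l : nat)].
have [lA lm] : l \in A /\ forall i, i \in A -> (l <= i)%N.
  by rewrite /l; case: arg_minnP.
rewrite -(setD1K lA); apply: PS.
- by rewrite !inE eqxx.
- by move=> i; rewrite !inE => /andP [il /lm]; rewrite leq_eqVlt val_eqE eq_sym (negPf il).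
by apply: IH; move: cA; rewrite (cardsD1 l) lA.
Qed.

Lemma shift_cycle_lower l A : below A -> l \notin A -> (l < a)%N ->
  (forall i, i \in A -> (l < i)%N) -> next_in A l (shift_cycle A a).
Proof.
move=> B lA la lm; have [ca cA cm] := shift_cycle_min B.
split; [|by []|by move=> d dA _; apply: cm].
by rewrite ca andbT; case: cA => [->|/lm].
Qed.

(** The increment is the indicator of the union of the rectangles of the single exchanges. Inserting
    a new smallest [l] adds its rectangle only up to the next position [c]; if [c] is in [A], the
    part beyond [c] already lies in the rectangle of [c], because [x c < x l]. *)
Lemma rank_rotate x A p k : decreasing_below x A ->
  rank (rotate x A) p k =
  (rank x p k + [exists i in A, (i < p <= a)%N && (x i < k <= x a)%N])%N.
Proof.
elim/set_min_ind: A => [_|l A lA lm IH D].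
  by rewrite rotate0; case: exists_inP => [[i]|_]; rewrite ?inE ?addn0.
have DA := decreasing_belowS (subsetU1 l A) D.
have /decreasing_belowP [B xa xd] := D; have /decreasing_belowP [BA _ _] := DA.
have la : (l < a)%N by apply: B; rewrite setU11.
have nc := shift_cycle_lower BA lA la lm.
set c := shift_cycle A a in nc; have [/andP [lc ca] cA cm] := nc.
have la' : l != a by rewrite -val_eqE neq_ltn la.
have rc : rotate x A c = x a by rewrite permM permK.
rewrite (rotate_insert _ BA lA nc) rank_tperm // ?rc rotate_id //; last by apply: xa; rewrite setU11.
rewrite (IH DA) -addnA; congr (_ + _)%N.
case: (boolP (_ && _)) => [/andP [/andP [lp pc] lk]|H].
  have -> : [exists i in A, (i < p <= a)%N && (x i < k <= x a)%N] = false.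
    apply/exists_inP => -[i iA /andP [/andP [ip _] _]].
    by have := cm i iA (lm i iA); lia.
  have -> // : [exists i in l |: A, (i < p <= a)%N && (x i < k <= x a)%N].
  by apply/exists_inP; exists l; rewrite ?setU11 // lk andbT lp /=; lia.
rewrite addn0; congr nat_of_bool; apply/exists_inP/exists_inP => -[i iA h].
  by exists i => //; rewrite inE iA orbT.
move: iA h; rewrite !inE => /orP [/eqP ->|iA h]; last by exists i.
move=> /andP [/andP [lp pa] lk]; rewrite lp lk andbT /= -ltnNge in H.
case: cA => [ca'|cA]; first by move: H; rewrite ca'; lia.
exists c => //; rewrite H pa /=; have := xd l c (setU11 _ _) _ lc.
by rewrite inE cA orbT => /(_ isT); lia.
Qed.

End ShiftCycle.

(** * Expansion of the tilde R-polynomial over rotations ending at [v] *)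

Section Expansion.
Import GRing.Theory.
Variables (n : nat) (a m : 'I_n).
Implicit Types (u v x : 'S_n) (i j b c d l : 'I_n) (A : {set 'I_n}).
Local Open Scope group_scope.

Definition unrotate v A := shift_cycle a A * v.

(* v is the rotation along A of some x with x a = m. *)
Definition rotation_of v A := (unrotate v A a == m) && decreasing_below a (unrotate v A) A.

Lemma rotation_min v A b : rotation_of v A -> v b = m -> min_in a A b.
Proof.
move=> /andP [/eqP e /decreasing_belowP [B _ _]] vb.
suff -> : b = shift_cycle a A a by apply: shift_cycle_min.
by apply: (@perm_inj _ v); rewrite vb -e permM.
Qed.

Lemma rotation_start v A b : rotation_of v A -> v b = m -> (b < a)%N -> b \in A.
Proof. by move=> g vb ba; have [_ [e|//] _] := rotation_min g vb; move: ba; rewrite e ltnn. Qed.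

Lemma rotation0 v A : v a = m -> rotation_of v A = (A == set0).
Proof.
move=> va; apply/idP/eqP => [g|->].
  have /andP [_ /decreasing_belowP [B _ _]] := g.
  have [_ _ h] := rotation_min g va.
  have [//|[i iA]] := set_0Vmem A; have := h i iA; have := B i iA; lia.
rewrite /rotation_of /unrotate shift_cycle0 mul1g va eqxx /=.
by apply/decreasing_belowP; split=> [i|i|i j]; rewrite inE.
Qed.

Lemma shift_cycle1 i : (i < a)%N -> shift_cycle a [set i] = tperm i a.
Proof.
move=> ia; rewrite -(setU0 [set i]) (@shift_cycle_insert _ _ _ _ a) ?shift_cycle0 ?mul1g ?inE //.
- by move=> j; rewrite inE.
- by split; [rewrite ia leqnn|left|move=> d; rewrite inE].
Qed.

Section Adjacent.
Variables (b c : 'I_n).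
Hypothesis cb : c = b.+1 :> nat.
Let t := tperm b c.

Let bc : b != c. Proof. by rewrite -val_eqE /=; lia. Qed.

Lemma tperm_adjacent_lt i j : ~~ ((i == b) && (j == c)) ->
  (i < j)%N -> (t i < t j)%N.
Proof.
rewrite /t -!val_eqE /= => h ij; move: h ij.
by case: tpermP => [->|->|/eqP + /eqP +]; case: tpermP => [->|->|/eqP + /eqP +];
  rewrite -?val_eqE /=; lia.
Qed.

Lemma imset_tpermK A : t @: (t @: A) = A.
Proof.
rewrite -imset_comp -[RHS]imset_id; apply: eq_imset => i /=; exact: tpermK.
Qed.

Lemma mem_imset_tperm A i : (i \in t @: A) = (t i \in A).
Proof. by rewrite -{1}(tpermK b c i) mem_imset //; apply: perm_inj. Qed.

Hypothesis ca : (c < a)%N.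

Let ta : t a = a.
Proof. by rewrite /t tpermD // -val_eqE /=; lia. Qed.

(** Unless both positions lie in [A], the exchange preserves the order within [A], so it simply
    conjugates the cycle. *)
Lemma unrotate_adjacent v A : ~~ ((b \in A) && (c \in A)) ->
  unrotate (t * v) (t @: A) = t * unrotate v A.
Proof.
move=> nbc; rewrite /unrotate shift_cycle_conj //; first by rewrite conjgE /t tpermV -!mulgA tpermKg.
move=> i j iA jA; apply: tperm_adjacent_lt.
by apply: contra nbc => /andP [/eqP <- /eqP <-]; rewrite iA.
Qed.

Lemma rotation_adjacent v A : ~~ ((b \in A) && (c \in A)) ->
  rotation_of v A -> rotation_of (t * v) (t @: A).
Proof.
move=> nbc /andP [e /decreasing_belowP [B xa xd]].
have tm i j : i \in A -> j \in A -> (t i < t j)%N -> (i < j)%N.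
  move=> iA jA tij; rewrite -(tpermK b c i) -(tpermK b c j); apply: tperm_adjacent_lt tij.
  apply: contra nbc => /andP [/eqP ib /eqP jc].
  have <- : i = c by rewrite -(tpermK b c i) -/t ib /t tpermL.
  have <- : j = b by rewrite -(tpermK b c j) -/t jc /t tpermR.
  by rewrite jA.
rewrite /rotation_of unrotate_adjacent // (permM t) ta e /=; apply/decreasing_belowP; split.
- move=> _ /imsetP [i iA ->]; have := B i iA; rewrite /t; case: tpermP => [-> //|->|//]; lia.
- by move=> _ /imsetP [i iA ->]; rewrite !(permM t) ta tpermK; apply: xa.
move=> _ _ /imsetP [i iA ->] /imsetP [j jA ->] /(tm _ _ iA jA) ij.
by rewrite !(permM t) !tpermK; apply: xd.
Qed.

(** In [t * v] the value [m] stands at [c], so by [rotation_min] a set rotating to [t * v] cannot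
    contain [b]; carried back by [t], this is the condition [c \notin A]. *)
Lemma rotation_adjacentE v A : v b = m ->
  rotation_of (t * v) (t @: A) = rotation_of v A && (c \notin A).
Proof.
move=> vb; apply/idP/andP => [g|[g cA]]; last by apply: rotation_adjacent; rewrite ?(negPf cA) ?andbF.
have vc : (t * v) c = m by rewrite permM /t tpermR.
have [_ _ h] := rotation_min g vc.
have cA : c \notin A.
  have := mem_imset_tperm A b; rewrite /t tpermL => <-; apply/negP => /h; lia.
split=> //; rewrite -(imset_tpermK A) -[v](tpermKg b c); apply: rotation_adjacent => //.
by rewrite !mem_imset_tperm /t tpermL tpermR (negPf cA).
Qed.

Lemma unrotate_add v A : v b = m -> b \in A -> c \notin A -> below a A -> (forall i, i \in A -> (b <= i)%N) ->
  unrotate v (c |: A) = t * unrotate v A.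
Proof.
move=> vb bA cA B hb.
have nbc : ~~ ((b \in A) && (c \in A)) by rewrite (negPf cA) andbF.
(* Adding [c] to [A] amounts to adding [b] to the image of [A], where [b] has the immediate
   successor [c] and thus contributes the factor [t]. *)
have -> : c |: A = b |: (t @: A).
  apply/setP => i; rewrite !inE mem_imset_tperm /t.
  case: tpermP => [->|->|/eqP ib /eqP ic]; rewrite ?eqxx ?bA ?orbT //.
  by rewrite (negPf ib) (negPf ic).
rewrite -unrotate_adjacent // /unrotate (@shift_cycle_insert _ _ _ _ c) ?mulgA //.
- move=> _ /imsetP [i iA ->]; have := B i iA; rewrite /t; case: tpermP => [-> //|->|//]; lia.
- by rewrite mem_imset_tperm /t tpermL.
split; [by lia| right; by rewrite mem_imset_tperm /t tpermR|].
by move=> d _; lia.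
Qed.

(** By [unrotate_add], enlarging the set by [c] exchanges the unrotated values at [b] and [c]; these
    must then decrease, so they increase beforehand. *)
Lemma rotation_add v A : v b = m -> (v c < m)%N -> c \notin A ->
  rotation_of v (c |: A) = rotation_of v A && (unrotate v A b < unrotate v A c)%N.
Proof.
move=> vb vc cA; have ba : (b < a)%N by lia.
have xc : below a A -> unrotate v A c = v c.
  by move=> B; rewrite permM shift_cycle_id // -val_eqE /=; lia.
apply/idP/andP => [g|[g lt]].
  have [_ _ h] := rotation_min g vb.
  have bA : b \in A by have := rotation_start g vb ba; rewrite !inE (negPf bc).
  have /andP [e /decreasing_belowP [B xa xd]] := g.
  have BA : below a A by move=> i iA; apply: B; rewrite inE iA orbT.
  have hA i : i \in A -> (b <= i)%N by move=> iA; apply: h; rewrite inE iA orbT.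
  move: e xa xd; rewrite unrotate_add // (permM t) ta => e xa xd.
  have lt : (unrotate v A b < unrotate v A c)%N.
    have := xd b c; rewrite !inE bA eqxx orbT !(permM t) tpermL tpermR; apply=> //; lia.
  split=> //; rewrite /rotation_of e; apply/decreasing_belowP; split=> //.
    move=> i iA; have [->|ib] := eqVneq i b.
      by apply: leq_trans lt _; rewrite xc // (eqP e) ltnW.
    have := xa i; rewrite !inE iA orbT !(permM t) tpermD 1?eq_sym //; first exact.
    by apply: contraNneq cA => <-.
  move=> i j iA jA ij.
  have jc : j != c by apply: contraNneq cA => <-.
  have ic : i != c by apply: contraNneq cA => <-.
  have bj : b != j by rewrite -val_eqE /=; have := hA i iA; lia.
  have tj : t j = j by rewrite /t tpermD // eq_sym.
  have [ib|ib] := eqVneq i b.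
    rewrite ib; have := xd c j; rewrite !inE eqxx jA orbT !(permM t) tj tpermR; apply=> //.
    by move: jc bj ij; rewrite ib -!val_eqE /=; lia.
  have ti : t i = i by rewrite /t tpermD 1?eq_sym.
  have := xd i j; rewrite !inE iA jA !orbT !(permM t) ti tj; exact.
have [_ _ h] := rotation_min g vb.
have bA := rotation_start g vb ba.
have /andP [e /decreasing_belowP [B xa xd]] := g.
rewrite /rotation_of unrotate_add // (permM t) ta e /=; apply/decreasing_belowP.
have tx i : i \in A -> i != b -> (t * unrotate v A) i = unrotate v A i.
  by move=> iA ib; rewrite (permM t) tpermD // 1?eq_sym //; apply: contraNneq cA => <-.
have tb : (t * unrotate v A) b = unrotate v A c by rewrite (permM t) tpermL.
have tc : (t * unrotate v A) c = unrotate v A b by rewrite (permM t) tpermR.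
have ta' : (t * unrotate v A) a = unrotate v A a by rewrite (permM t) ta.
split.
- by move=> i; rewrite !inE => /orP [/eqP -> //|/B].
- move=> i; rewrite !inE ta' => /orP [/eqP ->|iA]; first by rewrite tc xa.
  have [->|ib] := eqVneq i b; last by rewrite tx ?xa.
  by rewrite tb xc // (eqP e).
have key j : j \in A -> j != b -> (unrotate v A j < unrotate v A b)%N.
  move=> jA jb; apply: xd => //; have := h j jA; rewrite leq_eqVlt eq_sym.
  by rewrite val_eqE (negPf jb).
move=> i j; rewrite !inE => /orP [/eqP ->|iA] /orP [/eqP ->|jA] ij; first by rewrite ltnn in ij.
- have jb : j != b by rewrite -val_eqE /=; lia.
  by rewrite tc tx ?key.
- have ib : i == b.
    rewrite -val_eqE /=; have := h i iA; lia.
  by rewrite (eqP ib) tb tc.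
have jb : j != b by rewrite -val_eqE /=; have := h i iA; lia.
rewrite (tx j) //; have [->|ib] := eqVneq i b; last by rewrite tx ?xd.
by rewrite tb; apply: ltn_trans lt; apply: key.
Qed.

End Adjacent.

Local Open Scope ring_scope.

(** The quadratic relation (T_s + q)^2 = 1 + q (T_s + q). *)
Lemma hecke_op_sq (b c : 'I_n) (f : {ffun 'S_n -> {poly int}}) u :
  b != c -> hecke_op b c (hecke_op b c f) u = f u + 'X * hecke_op b c f u.
Proof.
move=> bc; have := inj_eq (@perm_inj _ u) b c; rewrite (negPf bc) => /negbT ne.
rewrite !ffunE !permM tpermL tpermR tpermKg.
by case: (ltngtP (u b) (u c)) => [_|_|/val_inj e]; [ring|ring|rewrite e eqxx in ne].
Qed.

Lemma rtilde_expansion u v b : agree_above m u v -> u a = m -> v b = m -> (b <= a)%N ->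
  rtilde v u = \sum_(A | rotation_of v A) 'X^#|A| * rtilde (unrotate v A) u.
Proof.
have [N] := ubnP (a - b); elim: N u v b => // N IH u v b; rewrite ltnS => lN ag ua vb.
rewrite leq_eqVlt => /orP [/eqP/val_inj e|ba].
  rewrite (eq_bigl (pred1 set0)); last by move=> A; rewrite rotation0 -?e.
  by rewrite big_pred1_eq cards0 expr0 mul1r /unrotate shift_cycle0 mul1g.
have cn : (b.+1 < n)%N by have := ltn_ord a; lia.
pose c := Ordinal cn; have cb : c = b.+1 :> nat by [].
have bc : b != c by rewrite -val_eqE /=; lia.
have ba' : b != a by rewrite -val_eqE /=; lia.
pose t := tperm b c.
have tvc : (t * v)%g c = m by rewrite (permM t) tpermR.
have ub : (u b < m)%N.
  rewrite ltn_neqAle val_eqE -{1}ua (inj_eq perm_inj) ba' /=.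
  by apply: (agree_above_le (agree_above_sym ag)); rewrite vb.
have vcm : v c != m by rewrite -vb (inj_eq perm_inj) eq_sym.
have agt : agree_above m (t * u)%g (t * v)%g by apply: agree_above_mulg.
have [ca|nca] := boolP (c == a).
  have vc : (v c < v b)%N.
    rewrite vb ltn_neqAle val_eqE vcm /=.
    by apply: (agree_above_le ag); rewrite (eqP ca) ua.
  rewrite (rtilde_ascent cb vc) ?(eqP ca) ?ua //; rewrite -(eqP ca) -/t.
  (* [t * u] has [m] at [b], left of its place in [t * v], so it is not below [t * v]. Only the term
     of [[set b]] survives. *)
  rewrite rtilde_eq0 ?add0r; last first.
    have tub : (t * u)%g b = m by rewrite permM tpermL (eqP ca) ua.
    by move=> h; have := position_antitone agt h tub tvc; lia.
  have k1 : shift_cycle a [set b] = t by rewrite shift_cycle1 // /t (eqP ca).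
  rewrite (eq_bigl (pred1 [set b])).
    by rewrite big_pred1_eq cards1 expr1 /unrotate k1.
  move=> A /=; apply/idP/eqP => [g|->].
    have [_ _ h] := rotation_min g vb.
    have bA := rotation_start g vb ba.
    have /andP [_ /decreasing_belowP [B _ _]] := g.
    apply/setP => i; rewrite inE; apply/idP/eqP => [iA|-> //].
    by apply: val_inj => /=; have := h i iA; have := B i iA; rewrite -(eqP ca) /=; lia.
  rewrite /rotation_of /unrotate k1 -{1}(eqP ca) tvc eqxx /=; apply/decreasing_belowP; split.
  - by move=> i; rewrite inE => /eqP ->.
  - by move=> i; rewrite inE => /eqP ->; rewrite -(eqP ca) tvc permM tpermL -vb.
  by move=> i j; rewrite !inE => /eqP -> /eqP ->; rewrite ltnn.
have {nca} ca : (c < a)%N by move: nca; rewrite -val_eqE /=; lia.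
have ta : t a = a by rewrite tpermD // -val_eqE /=; lia.
have tua : (t * u)%g a = m by rewrite permM ta.
have reind (F : {set 'I_n} -> {poly int}) :
    \sum_(A | rotation_of (t * v)%g A) F A = \sum_(A | rotation_of v A && (c \notin A)) F (t @: A).
  rewrite (reindex_onto (fun A : {set 'I_n} => t @: A) (fun A : {set 'I_n} => t @: A)) /=; last by move=> A _; apply: imset_tpermK.
  apply: eq_bigl => A; rewrite (rotation_adjacentE cb) //.
  by rewrite [t @: (t @: A)]imset_tpermK eqxx andbT.
have nbc A : c \notin A -> ~~ ((b \in A) && (c \in A)) by move=> h; rewrite (negPf h) andbF.
(* A value above [m] at [c] in [v] means one in [u] as well. Then [b], [c] is an ascent of [u], of
   [v] and of every unrotated permutation, so [t] can be applied to both arguments throughout. No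
   set in the sum contains [c], since unrotating puts only values up to [m] on the set and on
   [a]. *)
have [vcgt|vclt|/val_inj e] := ltngtP m (v c); last by rewrite e eqxx in vcm.
  have uc : (m < u c)%N by rewrite ag.
  have ubc : (u b < u c)%N by lia.
  have dsc x : (x b < x c)%N -> rtilde x u = rtilde (t * x)%g (t * u)%g.
    by move=> xbc; rewrite [RHS](@rtilde_descents _ _ _ b c) ?tpermKg ?permM ?tpermL ?tpermR.
  rewrite dsc ?vb // (IH (t * u)%g (t * v)%g c) //; last by lia.
  rewrite reind; symmetry; rewrite (bigID (fun A : {set 'I_n} => c \notin A)) /= [X in _ + X]big_pred0.
    rewrite addr0; apply: eq_bigr => A /andP [g cA].
    rewrite card_imset; last exact: perm_inj.
    rewrite unrotate_adjacent // ?nbc //; congr (_ * _); apply: dsc.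
    have /andP [/eqP xa /decreasing_belowP [B xlt _]] := g.
    have := xlt b (rotation_start g vb ba); rewrite xa.
    have -> : unrotate v A c = v c by rewrite permM shift_cycle_id // -val_eqE /=; lia.
    by move=> h; apply: ltn_trans h vcgt.
  move=> A; apply/negP => /andP [g]; rewrite negbK => cA.
  have /andP [/eqP xa /decreasing_belowP [B xlt _]] := g.
  pose y := ((shift_cycle a A)^-1 c)%g.
  have xy : unrotate v A y = v c by rewrite permM permKV.
  have [yA|yA] := boolP (y \in A); first by have := xlt y yA; rewrite xa xy; lia.
  have [ya|ya] := eqVneq y a; first by move: vcgt; rewrite -xy ya xa ltnn.
  by have := shift_cycle_id yA ya; rewrite permKV => e; move: yA; rewrite -e cA.
have dv : (v c < v b)%N by rewrite vb.
have agv : agree_above m v (t * v)%g.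
  move=> d k mk; rewrite permM; case: tpermP => [->|->|//]; rewrite vb; lia.
have agu : agree_above m u (t * v)%g := agree_above_trans ag agv.
rewrite (rtilde_descent cb dv) ffunE -/t.
rewrite (IH (t * u)%g (t * v)%g c) ?(IH u (t * v)%g c) //; try lia.
rewrite (_ : (if _ then _ else 0) = \sum_(A | rotation_of (t * v)%g A)
   (if (u b < u c)%N then 'X * ('X^#|A| * rtilde (unrotate (t * v)%g A) u) else 0)); last first.
  by case: ifP => _; [rewrite mulr_sumr|rewrite big1].
rewrite -big_split /=.
rewrite (eq_bigr (fun A : {set 'I_n} => 'X^#|A| * hecke_op b c (rtilde (unrotate (t * v)%g A)) u)); last first.
  by move=> A _; rewrite ffunE; case: ifP => _; ring.
(* On the right, each set containing [c] is paired with the set obtained by removing [c], so that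
   both sides run over sets without [c]. *)
rewrite reind [RHS](bigID (fun A : {set 'I_n} => c \notin A)) /=.
rewrite [X in _ = _ + X](reindex_onto (fun A : {set 'I_n} => c |: A) (fun A : {set 'I_n} => A :\ c)) /=; last first.
  by move=> A /andP [_]; rewrite negbK; apply: setD1K.
have E A : (rotation_of v (c |: A) && ~~ (c \notin c |: A)) && ((c |: A) :\ c == A) =
    (rotation_of v A && (c \notin A)) && (unrotate v A b < unrotate v A c)%N.
  rewrite negbK setU11 andbT; have [cA|cA] := boolP (c \in A).
    rewrite andbF /=; case: eqP => [e|_]; last by rewrite andbF.
    by move: cA; rewrite -e !inE eqxx.
  by rewrite setU1K // eqxx !andbT (rotation_add cb).
rewrite (eq_bigl _ _ E) [X in _ = _ + X]big_mkcondr -big_split /=.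
apply: eq_bigr => A /andP [g cA].
have /andP [_ /decreasing_belowP [B _ _]] := g.
have [_ _ h] := rotation_min g vb.
rewrite card_imset; last exact: perm_inj.
rewrite unrotate_adjacent ?nbc //.
rewrite (unrotate_add cb ca vb (rotation_start g vb ba) cA B h) cardsU1 cA add1n.
set x := unrotate v A.
(* If [x b < x c], the quadratic relation yields the terms of both [A] and [c |: A]; otherwise [b],
   [c] is a descent of [x] and only the term of [A] is present. *)
have [lt|lt|/val_inj/perm_inj e] := ltngtP (x b) (x c); last by rewrite e eqxx in bc.
  have d : ((t * x)%g c < (t * x)%g b)%N by rewrite !(permM t) tpermL tpermR.
  rewrite (rtilde_descent cb d) tpermKg.
  by rewrite hecke_op_sq // exprS; ring.
by rewrite addr0 (rtilde_descent cb lt).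
Qed.


End Expansion.

(** * Diamonds above two rotations that differ in one position *)

Section Diamonds.
Variables (n : nat) (a : 'I_n).
Implicit Types (x w : 'S_n) (i j c d p q y : 'I_n) (A : {set 'I_n}).
Local Open Scope group_scope.

(** If [s] fixed [p] or [q], the transposition on the left would send one of them to the other,
    hence equal [tperm p q], and [s] would be 1. *)
Lemma tperm_mul_support (s : 'S_n) p q p' q' : p != q -> s != 1 ->
  tperm p' q' = tperm p q * s -> s p != p /\ s q != q.
Proof.
move=> pq s1 e.
have key y z : tperm p' q' y = z -> y != z -> tperm p' q' = tperm y z.
  case: tpermP => [-> -> //|-> ->|_ _ ->]; first by rewrite tpermC.
  by rewrite eqxx.
have ne : tperm p' q' != tperm p q.
  by apply: contra s1 => /eqP e'; move: e; rewrite e' -{1}[tperm p q]mulg1 => /mulgI <-.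
split; apply: contraNneq ne => h; apply/eqP.
  by rewrite [tperm p q]tpermC; apply: key; rewrite 1?eq_sym // e permM tpermR.
by apply: key => //; rewrite e permM tpermL.
Qed.

Lemma tperm_mul_3cycle i j c p q p' q' : (i < j)%N -> (j < c)%N -> (p < q)%N ->
  tperm p q * tperm i c = tperm p' q' * tperm j c -> tperm p q != tperm i c ->
  (p = i /\ q = j) \/ (p = j /\ q = c).
Proof.
move=> ij jc pq e ne.
have [nij njc nic npq] : [/\ i != j, j != c, i != c & p != q].
  by rewrite -!val_eqE /=; split; lia.
have e' : tperm p' q' = tperm p q * (tperm i c * tperm j c).
  by rewrite mulgA e -mulgA tperm2 mulg1.
have s1 : tperm i c * tperm j c != 1.
  apply/eqP => /permP /(_ i); rewrite permM perm1 tpermL tpermR => h.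
  by move: nij; rewrite h eqxx.
have [sp sq] := tperm_mul_support npq s1 e'.
have supp y : (tperm i c * tperm j c) y != y -> [\/ y = i, y = j | y = c].
  rewrite permM; case: (tpermP i c y) => [->|->|_ _]; [by constructor 1|by constructor 3|].
  by case: tpermP => [->|->|_ _]; rewrite ?eqxx //; [constructor 2|constructor 3].
have := supp p sp; have := supp q sq; move=> [] hq [] hp; subst p q;
  try by exfalso; clear -pq ij jc; lia.
- by left.
- by rewrite eqxx in ne.
by right.
Qed.

(** In a product of two disjoint transpositions, a first factor mixing the two pairs would leave a
    second factor that is no involution. *)
Lemma tperm_mul_disjoint i c j d p q p' q' :
  (i < c)%N -> (c < j)%N -> (j < d)%N -> (p < q)%N ->
  tperm p q * tperm i c = tperm p' q' * tperm j d -> tperm p q != tperm i c ->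
  p = j /\ q = d.
Proof.
move=> ic cj jd pq e ne.
have npq : p != q by rewrite -!val_eqE /=; lia.
have [ni1 ni2 ni3] : [/\ i != c, i != j & i != d] by rewrite -!val_eqE /=; split; lia.
have [nc1 nc2 nc3] : [/\ c != j, c != d & j != d] by rewrite -!val_eqE /=; split; lia.
set s := tperm i c * tperm j d.
have si : s i = c by rewrite permM tpermL tpermD // eq_sym.
have sc : s c = i by rewrite permM tpermR tpermD // eq_sym.
have sj : s j = d by rewrite permM [tperm i c _]tpermD // tpermL.
have sd : s d = j by rewrite permM [tperm i c _]tpermD // tpermR.
have e' : tperm p' q' = tperm p q * s by rewrite mulgA e -mulgA tperm2 mulg1.
have s1 : s != 1 by apply/eqP => /permP /(_ i); rewrite si perm1 => h; rewrite h eqxx in ni1.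
have [sp sq] := tperm_mul_support npq s1 e'.
have supp y : s y != y -> [\/ y = i, y = c, y = j | y = d].
  rewrite permM; case: (tpermP i c y) => [->|->|_ _]; [by constructor 1|by constructor 2|].
  by case: tpermP => [->|->|_ _]; rewrite ?eqxx //; [constructor 3|constructor 4].
have mixed : s (s p) = p -> s p != q -> False.
  move=> ssp spq; have tq : tperm p' q' q = s p by rewrite e' permM tpermR.
  have tsp : tperm p' q' (s p) = p.
    by rewrite e' permM [tperm p q _]tpermD 1?[_ == s p]eq_sym.
  by have := tpermK p' q' q; rewrite tq tsp => h; rewrite h eqxx in npq.
have := supp p sp; have := supp q sq; move=> [] hq [] hp; subst p q;
  try by exfalso; clear -pq ic cj jd; lia.
- by rewrite eqxx in ne.
- by case: mixed; rewrite ?si ?sc ?sj ?sd.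
- by case: mixed; rewrite ?si ?sc ?sj ?sd.
- by case: mixed; rewrite ?si ?sc ?sj ?sd.
- by case: mixed; rewrite ?si ?sc ?sj ?sd.
by [].
Qed.

Lemma shift_cycleV_pred A c : below a A -> c = a \/ c \in A ->
  (shift_cycle a A)^-1 c = a \/
  ((shift_cycle a A)^-1 c \in A /\ ((shift_cycle a A)^-1 c < c)%N).
Proof.
elim/set_min_ind: A c => [|l A lA lm IH] c B cA.
  by left; rewrite shift_cycle0 invg1 perm1; case: cA => //; rewrite inE.
have BA : below a A by move=> i iA; apply: B; rewrite inE iA orbT.
have la : (l < a)%N by apply: B; rewrite setU11.
have nc := shift_cycle_lower BA lA la lm.
rewrite (shift_cycle_insert BA lA nc) invMg tpermV permM.
case: tpermP => [->|->|/eqP cl /eqP cc].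
- by left; rewrite permK.
- right; rewrite shift_cycleV_id ?setU11 //; last by rewrite -val_eqE /=; lia.
  by case: nc => /andP [].
have [|->|[h1 h2]] := IH c BA; last by right; rewrite inE h1 orbT.
  by case: cA => [|]; [left|rewrite !inE (negPf cl) /=; right].
by left.
Qed.

Lemma rotate_edge x A i : decreasing_below a x (i |: A) -> i \notin A ->
  exists c, [/\ next_in a A i c, rotate a x A i = x i, (x i < rotate a x A c)%N &
    rotate a x (i |: A) = tperm i c * rotate a x A].
Proof.
move=> /decreasing_belowP [B xa xd] iA.
have BA : below a A by move=> j jA; apply: B; rewrite inE jA orbT.
have ia : (i < a)%N by apply: B; rewrite setU11.
have [c nc _] := shift_cycle_split BA iA ia.
exists c; split=> //.
- by rewrite rotate_id // -val_eqE /=; lia.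
- have [ica cA cm] := nc; rewrite permM.
  have [->|[h1 h2]] := shift_cycleV_pred BA cA; first by apply: xa; rewrite setU11.
  apply: xd; rewrite ?setU11 //; first by rewrite inE h1 orbT.
  rewrite ltnNge leq_eqVlt negb_or; apply/andP; split.
    by apply: contraNneq iA => /val_inj ->.
  by apply/negP => /(cm _ h1); lia.
exact: rotate_insert.
Qed.

(** Every comparison in the enlarged set except that of [x i] with [x j] is already known. It is
    read off from the only upward exchange that can lead to [w]. *)
Lemma rotate_diamond x A i j w : (i < j)%N -> i \notin A -> j \notin A ->
  decreasing_below a x (i |: A) -> decreasing_below a x (j |: A) ->
  bedge (rotate a x (i |: A)) w -> bedge (rotate a x (j |: A)) w -> w != rotate a x A ->
  decreasing_below a x (j |: (i |: A)) /\ rotate a x (j |: (i |: A)) = w.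
Proof.
move=> ij iA jA Di Dj.
have [c [nc Wi Wc ->]] := rotate_edge Di iA.
have [d [nd Wj Wd ->]] := rotate_edge Dj jA.
have [ica cA cm] := nc; have [jda dA dm] := nd.
have /decreasing_belowP [Bi xai xdi] := Di; have /decreasing_belowP [Bj xaj xdj] := Dj.
move=> /bedgeP [p [q [pq Wpq ->]]] /bedgeP [p' [q' [_ _ E]]] ne.
have e : tperm p q * tperm i c = tperm p' q' * tperm j d.
  by apply: (@mulIg _ (rotate a x A)); rewrite -[LHS]mulgA -[RHS]mulgA.
have ne' : tperm p q != tperm i c.
  by apply: contra ne => /eqP ->; rewrite tpermKg.
(* Either no element of [A] lies between [i] and [j], and the two exchanges share their upper
   position, forming a 3-cycle, or the exchanges are disjoint. *)
have cd : c = d \/ (c < j)%N.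
  case: (ltngtP c j) => h; [by right| |].
    left; apply: (@next_in_uniq _ a A i) => //; first by move=> y yA; apply: Bi; rewrite inE yA orbT.
    have /andP [_ dA'] := jda; split=> [|//|y yA iy]; first by rewrite dA' (ltn_trans ij) //; case/andP: jda.
    by apply: dm => //; apply: leq_trans h (cm y yA iy).
  case: cA => [ca|]; first by case/andP: jda => jd da; move: (leq_trans jd da); rewrite -h ca ltnn.
  by rewrite (val_inj h) (negPf jA).
have [pj qd xji] : [/\ p = j, q = d & (x j < x i)%N].
  case: cd => [cd|cj].
    subst d; have jc : (j < c)%N by case/andP: jda.
    have nij : i != j by rewrite -val_eqE neq_ltn ij.
    have njc : c != j by rewrite -val_eqE neq_ltn jc orbT.
    (* The factor [tperm i j] would lead down: after the first exchange, position [i] carries the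
       former value at [c], which exceeds the value at [j]. *)
    have [[pi qj]|[pj qc]] := tperm_mul_3cycle ij jc pq e ne'.
      by move: Wpq; rewrite pi qj !(permM (tperm i c)) tpermL tpermD // Wj ltnNge (ltnW Wd).
    by move: Wpq; rewrite pj qc !(permM (tperm i c)) tpermR tpermD // Wj Wi.
  have cA' : c \in A by case: cA => // ca; case/andP: jda => jd da; move: (leq_trans jd da); rewrite -ca ltnNge ltnW.
  have ic : (i < c)%N by case/andP: ica.
  have jd : (j < d)%N by case/andP: jda.
  have [-> ->] := tperm_mul_disjoint ic cj jd pq e ne'; split=> //.
  apply: (@ltn_trans (x c)); first by apply: xdj; rewrite ?setU11 // inE cA' orbT.
  by apply: xdi; rewrite ?setU11 ?inE ?cA' ?orbT.
have D : decreasing_below a x (j |: (i |: A)).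
  apply/decreasing_belowP; split.
  - by move=> y; rewrite !inE => /or3P [/eqP ->|/eqP ->|yA]; [apply: Bj|apply: Bi|apply: Bi]; rewrite !inE ?eqxx ?yA ?orbT.
  - by move=> y; rewrite !inE => /or3P [/eqP ->|/eqP ->|yA]; [apply: xaj|apply: xai|apply: xai]; rewrite !inE ?eqxx ?yA ?orbT.
  move=> y z yA zA yz.
  have [yi|yi] := eqVneq y i; have [zj|zj] := eqVneq z j; first by rewrite yi zj.
  - apply: xdi => //; rewrite ?yi ?setU11 //; by move: zA; rewrite inE in_set1 (negPf zj).
  - have yj : y != j by rewrite -zj -val_eqE neq_ltn yz.
    by apply: xdj => //; rewrite ?zj ?setU11 //; move: yA; rewrite !inE (negPf yj) (negPf yi) /= => ->.
  have [zi|zi] := eqVneq z i.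
    have yj : y != j by rewrite -val_eqE neq_ltn /= (ltn_trans _ ij) // -zi.
    apply: xdi => //; rewrite ?zi ?setU11 //; by move: yA; rewrite inE in_set1 (negPf yj).
  have zA' : z \in A by move: zA; rewrite !inE (negPf zi) (negPf zj).
  apply: xdj => //; last by rewrite inE zA' orbT.
  by move: yA; rewrite !inE (negPf yi).
split=> //; rewrite pj qd.
have [|d' [nd' _ _ ->]] := @rotate_edge x (i |: A) j D.
  by rewrite inE in_set1 negb_or jA andbT -val_eqE neq_ltn ij orbT.
have -> : d' = d.
  apply: (next_in_uniq Bi nd'); split=> //; first by case: dA => [|h]; [left|right; rewrite inE h orbT].
  by move=> y; rewrite !inE => /orP [/eqP ->|/dm //]; rewrite ltnNge (ltnW ij).
by rewrite (rotate_insert x _ iA nc) //; move=> y yA; apply: Bi; rewrite inE yA orbT.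
Qed.

End Diamonds.

(** * The ideal, its clusters, and the polynomial identity *)

Section StandardDecomposition.
Import GRing.Theory.
Variables (n : nat) (u v : 'S_n) (m a b : 'I_n).
Hypotheses (uv : rank_le u v) (ag : agree_above m u v).
Hypotheses (ua : u a = m) (vb : v b = m) (ba : (b < a)%N).
Implicit Types (x y z w : 'S_n) (i j c : 'I_n) (Y : {set 'S_n}) (A : {set 'I_n}).
Local Open Scope group_scope.

Let X := bruhat_interval u v.
Definition standard_ideal : {set 'S_n} := [set x in bruhat_interval u v | x a == m].
Notation I := standard_ideal.

Lemma intervalP x : reflect (rank_le u x /\ rank_le x v) (x \in X).
Proof. by rewrite inE; apply: (iffP andP) => -[/bruhatP h1 /bruhatP h2]; split. Qed.

Lemma idealP x : reflect [/\ rank_le u x, rank_le x v & x a = m] (x \in I).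
Proof.
rewrite inE; apply: (iffP andP) => [[/intervalP [h1 h2] /eqP h3]|[h1 h2 h3]] //.
by split; [apply/intervalP|apply/eqP].
Qed.

Lemma interval_agree x : x \in X -> agree_above m u x.
Proof. by move=> /intervalP [h1 h2]; apply: agree_above_squeeze h1 h2 ag. Qed.

(** The position of [m] can only move left along the order; for [x] it is squeezed between its
    positions in [u] and [y], which are both [a]. *)
Lemma ideal_down x y : x \in X -> y \in I -> rank_le x y -> x \in I.
Proof.
move=> xX /idealP [uy yv ya] xy; have [ux xv] := intervalP _ xX.
apply/idealP; split=> //.
have agx := interval_agree xX.
have agxy : agree_above m x y.
  by apply: agree_above_trans (agree_above_sym agx) _; apply: interval_agree; apply/intervalP.
have h1 := position_antitone agx ux ua (permKV x m).
have h2 := position_antitone agxy xy (permKV x m) ya.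
have -> : a = x^-1 m by apply: val_inj; apply/eqP; rewrite eqn_leq h1 h2.
exact: permKV.
Qed.

Lemma ideal_interval : exists2 z, z \in X & I = bruhat_interval u z.
Proof.
have [z [zv za zm]] : exists z, [/\ rank_le z v, z a = m &
    forall x, rank_le x v -> agree_above m x v -> x a = m -> rank_le x z].
  by apply: (rank_max_at vb) (ltnW ba) _; apply: (agree_above_le ag); rewrite ua.
have uz : rank_le u z by apply: zm.
have zX : z \in X by apply/intervalP.
exists z => //; apply/setP => x; apply/idP/idP.
  move=> /idealP [ux xv xa]; rewrite inE; apply/andP; split; apply/bruhatP => //.
  apply: zm => //; apply: agree_above_trans (agree_above_sym _) ag.
  by apply: interval_agree; apply/intervalP.
rewrite inE => /andP [/bruhatP ux /bruhatP xz]; apply: (@ideal_down x z) => //.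
  by apply/intervalP; split=> //; apply: rank_le_trans zv.
by apply/idealP.
Qed.

Lemma ideal_proper : I \proper X.
Proof.
apply/properP; split; first by apply/subsetP => x; rewrite inE => /andP [].
exists v; first by apply/intervalP; split=> //; apply: rank_le_refl.
apply/negP => /idealP [_ _ va]; move: ba.
by rewrite (_ : b = a) ?ltnn //; apply: (@perm_inj _ v); rewrite vb.
Qed.

Definition raise x i := tperm i a * x.

Lemma raise_inj x : injective (raise x).
Proof.
move=> i j /mulIg /permP /(_ a); by rewrite !tpermR.
Qed.

Lemma ideal_exit x y : x \in I -> y \in X -> y \notin I -> bedge x y ->
  exists i, [/\ (i < a)%N, (x i < m)%N & y = raise x i].
Proof.
move=> xI yX yI /bedgeP [i [j [ij xij e]]].
have /idealP [ux xv xa] := xI.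
have xX : x \in X by apply/intervalP.
have agxy : agree_above m x y.
  by apply: agree_above_trans (agree_above_sym (interval_agree xX)) (interval_agree yX).
have [ja|ja] := eqVneq j a.
  by rewrite ja in ij xij e; exists i; split; rewrite // -xa.
(* If [a] were the left position of the exchange, a value above [m] would move, against agreement
   above [m]. *)
have ia : i != a.
  apply/eqP => ia; have := agxy j m.+1 (ltnSn m); rewrite e permM tpermR ia xa ltnn.
  by move: xij; rewrite ia xa => ->.
case/negP: yI; apply/idealP; have [uy yv] := intervalP _ yX; split=> //.
by rewrite e permM tpermD.
Qed.

Lemma bedge_raise x i : x a = m -> (i < a)%N -> (x i < m)%N -> bedge x (raise x i).
Proof. by move=> xa ia xi; apply/bedgeP; exists i, a; rewrite xa. Qed.

Lemma YsetP x y : x \in I ->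
  reflect (exists i, [/\ (i < a)%N, (x i < m)%N, rank_le (raise x i) v & y = raise x i])
    (y \in Yset u v I x).
Proof.
move=> xI; have /idealP [ux xv xa] := xI; rewrite inE; apply: (iffP andP).
  case=> /andP [yX yI] e; have [i [ia xi ey]] := ideal_exit xI yX yI e.
  by exists i; split=> //; have [_] := intervalP _ yX; rewrite ey.
case=> i [ia xi yv ->]; have e := bedge_raise xa ia xi; split=> //; apply/andP; split.
  by apply/intervalP; split=> //; apply: rank_le_trans ux (rank_le_bedge e).
apply/negP => /idealP [_ _]; rewrite /raise permM tpermR => h.
by move: xi; rewrite h ltnn.
Qed.

Lemma rank_raise x i p k : x a = m -> (i < a)%N -> (x i < m)%N ->
  rank (raise x i) p k = (rank x p k + ((i < p <= a) && (x i < k <= m)))%N.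
Proof. by move=> xa ia xi; rewrite rank_tperm ?xa. Qed.

Definition positions x Y := [set i | raise x i \in Y].
Definition raises x A := [set raise x i | i in A].

Lemma raisesK x A : positions x (raises x A) = A.
Proof. by apply/setP => i; rewrite inE mem_imset //; apply: raise_inj. Qed.

Lemma positionsK x Y : x \in I -> Y \subset Yset u v I x -> raises x (positions x Y) = Y.
Proof.
move=> xI /subsetP s; apply/setP => y; apply/imsetP/idP => [[i]|yY].
  by rewrite inE => h ->.
have /(YsetP _ xI) [i [_ _ _ e]] := s y yY.
by exists i; rewrite // inE -e.
Qed.

Lemma positions_raise x Y i : x \in I -> Y \subset Yset u v I x -> i \in positions x Y ->
  [/\ (i < a)%N, (x i < m)%N & rank_le (raise x i) v].
Proof.
move=> xI /subsetP s; rewrite inE => /s /(YsetP _ xI) [j [ja xj jv e]].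
by rewrite (raise_inj e).
Qed.

(** Comparing two raises means testing inclusion of rectangles with the common corner [(a, m)],
    hence comparing both coordinates of the corners [(i, x i)]. *)
Lemma inA_decreasing x Y : x \in I ->
  inA u v I x Y = (Y \subset Yset u v I x) && decreasing_below a x (positions x Y).
Proof.
move=> xI; have /idealP [_ _ xa] := xI.
rewrite /inA; case s: (Y \subset _) => //=; apply/idP/idP.
  move=> /forall_inP ac; apply/decreasing_belowP.
  have P i := positions_raise xI s (i := i).
  split; [by move=> i /P []|by move=> i /P []; rewrite xa|].
  move=> i j iA jA ij; have [ia xi _] := P i iA; have [ja xj _] := P j jA.
  rewrite ltnNge leq_eqVlt negb_or; apply/andP; split.
    by apply/eqP => /val_inj/perm_inj e; rewrite e ltnn in ij.
  apply/negP => xij.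
  move: iA jA; rewrite !inE => iY jY.
  have ne : raise x j != raise x i by rewrite (inj_eq (@raise_inj x)) -val_eqE neq_ltn ij orbT.
  have /forall_inP /(_ _ iY) /implyP /(_ ne) /negP := ac _ jY; apply; apply/bruhatP => p k.
  by rewrite !rank_raise // leq_add2l; clear -ij xij; lia.
move=> /decreasing_belowP [B xlt xd].
have half i j p k : i \in positions x Y -> j \in positions x Y -> (i < p <= a)%N -> (x i < k <= m)%N ->
  ~~ ((j < p) && (x j < k))%N -> ~ rank_le (raise x i) (raise x j).
  move=> iA jA hp hk nj /(_ p k); rewrite !rank_raise // ?B //; try by rewrite -xa xlt.
  by rewrite hp hk; clear -nj; lia.
apply/forall_inP => y yY; apply/forall_inP => y' yY'; apply/implyP => ne; apply/bruhatP.
move: yY yY' ne; rewrite -{1 2}(positionsK xI s) => /imsetP [i iA ->] /imsetP [j jA ->].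
rewrite (inj_eq (@raise_inj x)) -val_eqE neq_ltn => /orP [ij|ji].
  (* The witness lies in the first column of the rectangle of [i] when [i < j], and at its lowest
     level, [(x i).+1], when [j < i]. *)
  apply: (@half i j i.+1 m) => //; [by rewrite ltnS leqnn B|by rewrite leqnn -xa xlt|].
  by rewrite negb_and -leqNgt ij.
have xji := xd j i jA iA ji.
apply: (@half i j a (x i).+1) => //; [by rewrite leqnn B|by rewrite ltnSn -xa xlt|].
by rewrite negb_and -[in X in _ || X]leqNgt xji orbT.
Qed.

Definition standard_cluster x Y := rotate a x (positions x Y).
Notation th := standard_cluster.

Lemma inA_positions x Y : x \in I -> inA u v I x Y -> decreasing_below a x (positions x Y).
Proof. by move=> xI; rewrite inA_decreasing // => /andP []. Qed.

Lemma rank_le_rotate x A : decreasing_below a x A -> rank_le x (rotate a x A).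
Proof. by move=> D p k; rewrite rank_rotate // leq_addr. Qed.

Lemma raise_le_rotate x A i : x a = m -> decreasing_below a x A -> i \in A ->
  rank_le (raise x i) (rotate a x A).
Proof.
move=> xa D iA p k; have /decreasing_belowP [B xlt _] := D.
rewrite rank_rotate // rank_raise // ?B // -?xa ?xlt // leq_add2l.
case: (boolP (_ && _)) => // h; suff -> : [exists i in A, (i < p <= a)%N && (x i < k <= x a)%N] by [].
by apply/exists_inP; exists i.
Qed.

(** Wherever the rotation raises a count, a single raise from [Y] already raises it equally and
    stays below [v]. *)
Lemma cluster_interval x Y : x \in I -> inA u v I x Y -> th x Y \in X.
Proof.
move=> xI iY; have D := inA_positions xI iY; have /idealP [ux xv xa] := xI.
have s : Y \subset Yset u v I x by case/andP: iY.
apply/intervalP; split; first exact: rank_le_trans ux (rank_le_rotate D).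
move=> p k; rewrite rank_rotate //; case: exists_inP => [[i iA h]|_]; last by rewrite addn0.
have [ia xi /(_ p k)] := positions_raise xI s iA.
by rewrite xa in h; rewrite rank_raise // h.
Qed.

Lemma standard_strong_cluster x : x \in I -> strong_cluster u v I x (th x).
Proof.
move=> xI; have /idealP [ux xv xa] := xI; split.
- by move=> Y; apply: cluster_interval.
- by rewrite /th (_ : positions x set0 = set0) ?rotate0 //; apply/setP => i; rewrite !inE.
- move=> _ /(YsetP _ xI) [i [ia xi _ ->]].
  rewrite /th (_ : positions x [set raise x i] = [set i]) ?rotate1 //.
  by apply/setP => j; rewrite !inE (inj_eq (@raise_inj x)).
- move=> Y1 Y2 i1 i2 s12 /eqP /cards1P [y ey].
  have s2 : Y2 \subset Yset u v I x by case/andP: i2.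
  have yY2 : y \in Y2 by have := set11 y; rewrite -ey inE => /andP [].
  have /(YsetP _ xI) [i [_ _ _ e]] := subsetP s2 y yY2.
  have e2 : positions x Y2 = i |: positions x Y1.
    apply/setP => j; rewrite !inE -(inj_eq (@raise_inj x)) -e.
    have := in_set1 (raise x j) y; rewrite -ey inE => <-.
    by case h: (raise x j \in Y1); rewrite /= ?orbF ?(subsetP s12 _ h).
  have nY1 : i \notin positions x Y1.
    by rewrite inE -e; have := set11 y; rewrite -ey inE => /andP [].
  have D := inA_positions xI i2; rewrite /th; rewrite e2 in D *.
  have [c [nc Wi Wc ->]] := rotate_edge D nY1.
  by apply/bedgeP; exists i, c; split; rewrite ?Wi //; have [/andP []] := nc.
move=> Y Y' w iY iY' cYY' cY /and5P [_ un e1 e2 /andP [e3 e4]].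
have s : Y \subset Yset u v I x by case/andP: iY.
have s' : Y' \subset Yset u v I x by case/andP: iY'.
have extend Z Z' : inA u v I x Z -> #|Z| = #|Z :&: Z'|.+1 ->
    exists2 i, i \notin positions x Z' & positions x Z = i |: positions x (Z :&: Z').
  move=> iZ cZ; have sZ : Z \subset Yset u v I x by case/andP: iZ.
  have /eqP /cards1P [y ey] : #|Z :\: Z'| = 1%N by rewrite cardsD cZ subSnn.
  have yZ : y \in Z :\: Z' by rewrite ey set11.
  move: (yZ); rewrite inE => /andP [yZ' yZZ].
  have /(YsetP _ xI) [i [_ _ _ e]] := subsetP sZ y yZZ.
  exists i; first by rewrite inE -e.
  apply/setP => j; rewrite !inE -(inj_eq (@raise_inj x)) -e.
  have := in_set1 (raise x j) y; rewrite -ey inE => <-.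
  by case: (_ \in Z'); case: (_ \in Z).
have [i iZ eZ] := extend Y Y' iY cY.
have [j jZ eZ'] : exists2 j, j \notin positions x Y & positions x Y' = j |: positions x (Y' :&: Y).
  by apply: extend; rewrite // setIC -cYY'.
rewrite setIC in eZ'; set A := positions x (Y :&: Y') in eZ eZ'.
have iA : i \notin A by apply: contra iZ; rewrite !inE => /andP [].
have jA : j \notin A by apply: contra jZ; rewrite !inE => /andP [].
have Di := inA_positions xI iY; have Dj := inA_positions xI iY'.
have eU : positions x (Y :|: Y') = i |: (j |: A).
  rewrite (_ : positions x (Y :|: Y') = positions x Y :|: positions x Y').
    by rewrite eZ eZ' setUACA setUid setUA.
  by apply/setP => k; rewrite !inE.
have wne : w != rotate a x A.
  by move: un => /=; rewrite !inE !negb_or => /andP [/and3P [_ _]]; rewrite eq_sym.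
rewrite /th -/A eZ in e1 e2; rewrite /th -/A eZ' in e3 e4; rewrite eZ in Di; rewrite eZ' in Dj.
have [D wE] : decreasing_below a x (i |: (j |: A)) /\ rotate a x (i |: (j |: A)) = w.
  have ij : i != j.
    by apply: contraNneq iZ => ->; rewrite eZ' setU11.
  move: ij; rewrite -val_eqE neq_ltn => /orP [ij|ji]; last exact: rotate_diamond.
  by rewrite setUCA; apply: rotate_diamond.
split; last by rewrite /th eU.
have : inA u v I x (Y :|: Y') by rewrite inA_decreasing // eU D subUset s s'.
by case/andP.
Qed.

Lemma ideal_diamond_closed : diamond_closed u v I.
Proof.
split; first by apply/subsetP => x; rewrite inE => /andP [].
move=> x1 x2 x3 x4 /and5P [/= /and5P [X1 X2 X3 X4 _] un e12 e24 /andP [e13 e34]] cnt.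
have down x y : x \in X -> bedge x y -> y \in I -> x \in I.
  by move=> xX e yI; apply: ideal_down xX yI (rank_le_bedge e).
have [h4|h4] := boolP (x4 \in I).
  have h2 := down _ _ X2 e24 h4; have h3 := down _ _ X3 e34 h4.
  by rewrite /= (down _ _ X1 e12 h2) h2 h3.
have [h1 h2 h3] : [/\ x1 \in I, x2 \in I & x3 \in I].
  by move: cnt; rewrite /= (negPf h4); case: (x1 \in I); case: (x2 \in I); case: (x3 \in I).
have [i [_ _ e2]] := ideal_exit h2 X4 h4 e24.
have [j [_ _ e3]] := ideal_exit h3 X4 h4 e34.
have /idealP [_ _ a2] := h2; have /idealP [_ _ a3] := h3.
(* Both are the position of [m] in [x4], so [x2] and [x3] arise from [x4] by the same exchange. *)
have ij : i = j.
  by apply: (@perm_inj _ x4); rewrite {1}e2 e3 /raise !permM !tpermL a2 a3.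
have e23 : x2 = x3 by apply: (@mulgI _ (tperm i a)); rewrite -/(raise x2 i) -e2 e3 ij.
by move: un; rewrite e23 /= !inE eqxx !andbF.
Qed.

Local Open Scope ring_scope.

Lemma Htilde_standard : Rtilde u v = Htilde u v I th.
Proof.
rewrite Rtilde_rtilde (rtilde_expansion ag ua vb (ltnW ba)) /Htilde.
pose P x A := decreasing_below a x A && (rotate a x A == v).
have inner x : x \in I ->
    \sum_(Y : {set 'S_n} | inA u v I x Y && (th x Y == v)) 'X^#|Y| * Rtilde u x =
    \sum_(A | P x A) 'X^#|A| * rtilde x u.
  move=> xI; have /idealP [_ _ xa] := xI.
  rewrite (reindex_onto (raises x) (positions x)) /=; last first.
    by move=> Y /andP [/andP [s _] _]; apply: positionsK.
  apply: eq_big => [A|A _]; last by rewrite Rtilde_rtilde card_imset //; apply: raise_inj.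
  rewrite raisesK eqxx andbT inA_decreasing // /th raisesK /P -andbA.
  (* Membership in [Yset] is automatic: each raise lies below the rotation, which is [v]. *)
  apply: andb_idl => /andP [D /eqP e]; apply/subsetP => _ /imsetP [i iA ->].
  have /decreasing_belowP [B xlt _] := D.
  apply/YsetP => //; exists i; split=> //; [exact: B|by rewrite -xa xlt|].
  by rewrite -e; apply: raise_le_rotate.
rewrite (eq_bigr _ inner) (exchange_big_dep xpredT) //= big_mkcond.
apply: eq_bigr => A _; set x := unrotate a v A.
have Ex y : (rotate a y A == v) = (y == x).
  by rewrite /rotate /x /unrotate; apply/eqP/eqP => [<-|->]; rewrite mulgA ?mulgV ?mulVg mul1g.
case: ifP => g; last first.
  rewrite big_pred0 // => y; apply/negP => /andP [/idealP [_ _ ya] /andP [D]].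
  by rewrite Ex => /eqP e; move: g; rewrite /rotation_of -/x -e ya eqxx D.
have /andP [/eqP xa D] := g; rewrite -/x in xa D.
have xv : rank_le x v by have := rank_le_rotate D; rewrite (eqP (_ : rotate a x A == v)) // Ex.
have [/bruhatP ux|nux] := boolP (bruhat u x).
  rewrite (big_pred1 x) // => y; rewrite /P Ex /=.
  have [->|] := eqVneq y x; last by rewrite !andbF.
  by rewrite D !andbT; apply/idealP.
(* Here [x] is not in the ideal and contributes nothing on the right; its term on the left vanishes
   as well. *)
rewrite rtilde_eq0 ?mulr0; last by move=> /bruhatP; apply/negP.
by rewrite big1 // => y /andP [/idealP [uy _ _] /andP [_]]; rewrite Ex => /eqP e;
  move: nux; rewrite -e => /negP []; apply/bruhatP.
Qed.

End StandardDecomposition.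

Theorem theorem5p1 (n : nat) (u v : 'S_n) :
  bruhat u v -> u != v ->
  exists (I : {set 'S_n}) (th : 'S_n -> {set 'S_n} -> 'S_n),
    [/\ I \proper bruhat_interval u v, strong_hcd u v I th & Rtilde u v = Htilde u v I th].
Proof.
move=> /bruhatP uv /max_disagreement [m [ag ne]].
have ua := permKV u m; have vb := permKV v m; set a := (u^-1 m)%g in ua ne; set b := (v^-1 m)%g in vb ne.
have ba : (b < a)%N.
  by have := position_antitone ag uv ua vb; rewrite leq_eqVlt eq_sym val_eqE (negPf ne).
exists (standard_ideal u v m a), (standard_cluster a); split.
- exact: (ideal_proper uv vb ba).
- have [z zX eI] := ideal_interval uv ag ua vb ba.
  exists z; split=> //; first exact: (ideal_diamond_closed ag ua).
  by move=> x; apply: (standard_strong_cluster ag).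
exact: (Htilde_standard ag ua vb ba).
Qed.
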